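(* Let $\mathcal{T}=(V,A,E,f,q,v_0)$ be a decorated pseudo-rooted tree and let $\mathscr{P}=\{X_1,\dots,X_n\}$ be a partition of $A\setminus A_0$. Then (a) $\delta(\mathcal{T})=\sum_{\alpha\in A\setminus A_0}\delta(\mathcal{T}_\alpha)-\sum_{\alpha\in A\setminus A_0}\mathfrak{D}(\mathcal{T},\{\alpha\})+\tfrac12 I(A\setminus A_0,A\setminus A_0)$; (b) $\delta(\mathcal{T})=\sum_{i=1}^n\delta(\mathcal{T}_{X_i})-\sum_{i=1}^n\mathfrak{D}(\mathcal{T},X_i)+\sum_{i<j}I(X_i,X_j)$; (c) $g(\mathcal{T})-1=\sum_{\alpha\in A\setminus A_0}(g(\mathcal{T}_\alpha)-1)-\sum_{\alpha\in A\setminus A_0}\mathfrak{G}(\mathcal{T},\{\alpha\})+\tfrac12 I(A\setminus A_0,A\setminus A_0)$; (d) $g(\mathcal{T})-1=\sum_{i=1}^n(g(\mathcal{T}_{X_i})-1)-\sum_{i=1}^n\mathfrak{G}(\mathcal{T},X_i)+\sum_{i<j}I(X_i,X_j)$.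
   Context: A graph is a pair $(X_0,X_1)$ of finite sets such that each element of $X_1$ (an edge) is a $2$-element subset of $X_0$; elements of $X_0$ are called cells. The valency $\delta_x$ of a cell $x$ is the number of edges containing $x$. A path is a tuple $(x_0,\dots,x_n)$ ($n\ge 0$) of cells such that $\{x_i,x_{i+1}\}$ is an edge for each $i<n$ and these edges are pairwise distinct; a cell (resp. edge) is in the path if it is one of the $x_i$ (resp. one of the $\{x_i,x_{i+1}\}$). The graph is a tree if for any cells $x,y$ there is a unique path from $x$ to $y$, denoted $\gamma_{x,y}$. A decorated tree is a $5$-tuple $(V,A,E,f,q)$ where $V$ (vertices) and $A$ (arrows) are finite disjoint sets, $(V\cup A,E)$ is a tree, every arrow has valency $1$, $f:A\to\mathbb{Z}$, $q$ assigns an integer $q(e,x)$ to each pair $(e,x)$ with $e\in E$, $x\in e$, such that $q(e,\alpha)=1$ whenever $\alpha\in A$, and for every $v\in V$ and distinct edges $e,e'$ containing $v$, $\gcd(q(e,v),q(e',v))=1$. Let $A_0=\{\alpha\in A: f(\alpha)=0\}$. For $x\in V\cup A$ and an edge $e\ni x$, $Q(e,x)=\prod q(e',x)$ over edges $e'\neq e$ containing $x$ (empty products equal $1$). An edge $\varepsilon$ is incident to a path $\gamma$ if $\varepsilon$ is not in $\gamma$ but contains some cell $u$ of $\gamma$; then $q(\varepsilon,\gamma):=q(\varepsilon,u)$. For $v\in V\cup A$, $\alpha\in A$, $v\ne\alpha$: $x_{v,\alpha}=f(\alpha)\prod_\varepsilon q(\varepsilon,\gamma_{v,\alpha})$ over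 edges $\varepsilon$ incident to $\gamma_{v,\alpha}$, and $\hat x_{v,\alpha}$ is the same with the product restricted to $\varepsilon$ not containing $v$. For $v\in V\cup A_0$, $N_v=\sum_{\alpha\in A\setminus A_0}x_{v,\alpha}$; $M(\mathcal{T})=-\sum_{v\in V\cup A_0}N_v(\delta_v-2)$. For $u\in V\cup A$ and an edge $e\ni u$, $p(u,e)=\sum\hat x_{u,\alpha}$ over $\alpha\in A\setminus A_0$ with $e$ in $\gamma_{u,\alpha}$. For $\alpha\in A\setminus A_0$ with unique edge $e_\alpha$, $F(\alpha)=\gcd(f(\alpha),p(\alpha,e_\alpha))\ge0$; $F(\mathcal{T})=\sum_{\alpha\in A\setminus A_0}F(\alpha)$. Genus $g(\mathcal{T})=\tfrac12(2-M(\mathcal{T})-F(\mathcal{T}))$, $\delta$-invariant $\delta(\mathcal{T})=\tfrac12(F(\mathcal{T})-M(\mathcal{T}))$. For a path $\gamma=(x_0,\dots,x_n)$, $n>0$, and a cell $u$ of $\gamma$, $Q(\gamma,u)=\prod q(\varepsilon,u)$ over edges $\varepsilon$ containing $u$ not in $\gamma$; $Q^*(\gamma)=\prod_{0<i<n}Q(\gamma,x_i)$. For $X,Y\subseteq A\setminus A_0$, $I(X,Y)=\sum_{(\alpha,\beta)\in X\times Y,\,\alpha\neq\beta}Q^*(\gamma_{\alpha,\beta})f(\alpha)f(\beta)$. For $X\subseteq A\setminus A_0$ and $X^c=(A\setminus A_0)\setminus X$: $\mathfrak{M}(\mathcal{T},X)=\sum_{\alpha\in X}(1-\tfrac1{f(\alpha)})I(\{\alpha\},X^c)$,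 $\mathfrak{D}(\mathcal{T},X)=\tfrac12\mathfrak{M}(\mathcal{T},X)-\tfrac12\sum_{\alpha\in X}(F(\alpha)-F_X(\alpha))$, $\mathfrak{G}(\mathcal{T},X)=\tfrac12\mathfrak{M}(\mathcal{T},X)+\tfrac12\sum_{\alpha\in X}(F(\alpha)-F_X(\alpha))$, where $F_X(\alpha)$ is $F(\alpha)$ computed in $\mathcal{T}_X$ (defined below). A pseudo-root of $(V,A,E,f,q)$ is a vertex $v_0$ with $q(e,v_0)=1$ for all edges $e\ni v_0$, such that for every $v\in V\setminus\{v_0\}$ at most one edge $e\ni v$ not in $\gamma_{v_0,v}$ has $q(e,v)\ne1$. A decorated pseudo-rooted tree is $(V,A,E,f,q,v_0)$ with $v_0$ a pseudo-root. For nonempty $X\subseteq A\setminus A_0$, $\mathcal{T}_X$: let $\mathcal{T}'_X$ have arrow set $X$, vertices those of $\mathcal{T}$ on some $\gamma_{v_0,\alpha}$ ($\alpha\in X$), edges those of $\mathcal{T}$ in some $\gamma_{v_0,\alpha}$ ($\alpha\in X$), decorations as in $\mathcal{T}$; for each vertex $v$ of $\mathcal{T}'_X$ put $b_v=\prod q(e,v)$ over edges $e$ of $\mathcal{T}$ containing $v$ not in $\mathcal{T}'_X$, and if $b_v\ne1$ add an arrow $\alpha_v$ with $f(\alpha_v)=0$ and edge $\{v,\alpha_v\}$ decorated $b_v$ near $v$, $1$ near $\alpha_v$. The result, pseudo-rooted at $v_0$, is $\mathcal{T}_X$; $\mathcal{T}_\alpha:=\mathcal{T}_{\{\alpha\}}$.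 Partitions consist of nonempty sets. *)

(* Defs.v *)
From HB Require Import structures.
From mathcomp Require Import all_boot all_order all_algebra.
From Stdlib Require Import ClassicalEpsilon.
Set Implicit Arguments. Unset Strict Implicit. Unset Printing Implicit Defensive.
Import Order.TTheory GRing.Theory Num.Theory.
Local Open Scope ring_scope.

(* A decorated tree on cells of a finite type T: vertices V, arrows A,
   edges E (2-element subsets), f : A -> Z (extended to T), and
   q(e,x) (extended to all pairs). *)
Record dtree (T : finType) := DTree {
  dV : {set T}; dA : {set T}; dE : {set {set T}};
  df : T -> int; dq : {set T} -> T -> int }.

Section Basic.
Variables (T : finType) (t : dtree T).
Local Notation V := (dV t). Local Notation A := (dA t).
Local Notation E := (dE t). Local Notation f := (df t). Local Notation q := (dq t).

Definition cells : {set T} := V :|: A.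
Definition edges_at (x : T) : {set {set T}} := [set e in E | x \in e].
Definition valency (x : T) : nat := #|edges_at x|.
Definition A0 : {set T} := [set a in A | f a == 0].
Definition Ann : {set T} := A :\: A0.

(* A path (x_0,...,x_n) is represented by x_0 and the tail s = [x_1;...;x_n]. *)
Definition pedges (x : T) (s : seq T) : seq {set T} :=
  pairmap (fun a b => [set a; b]) x s.
Definition is_pathb (x y : T) (s : seq T) : bool :=
  [&& all (mem cells) (x :: s), all (mem E) (pedges x s),
      uniq (pedges x s) & last x s == y].
Definition is_tree : Prop :=
  forall x y, x \in cells -> y \in cells -> exists! s, is_pathb x y s.
(* gamma x y : the (tail of the) unique path from x to y (arbitrary if none) *)
Definition gamma (x y : T) : seq T :=
  match excluded_middle_informative (exists s, is_pathb x y s) with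
  | left H => xchoose H
  | right _ => [::]
  end.

Definition decorated : Prop :=
  [disjoint V & A] /\
  (forall e, e \in E -> (e \subset cells) && (#|e| == 2)) /\
  is_tree /\
  (forall a, a \in A -> valency a = 1) /\
  (forall e a, e \in E -> a \in A -> a \in e -> q e a = 1) /\
  (forall v e e', v \in V -> e \in E -> e' \in E -> v \in e -> v \in e' ->
      e != e' -> gcdz (q e v) (q e' v) = 1).

Definition incident (x : T) (s : seq T) (e : {set T}) : bool :=
  [&& e \in E, e \notin pedges x s & has (fun u => u \in e) (x :: s)].
Definition qpath (x : T) (s : seq T) (e : {set T}) : int :=
  q e (head x [seq u <- x :: s | u \in e]).

Definition xva (v a : T) : int :=
  f a * \prod_(e in E | incident v (gamma v a) e) qpath v (gamma v a) e.
Definition xhat (v a : T) : int :=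
  f a * \prod_(e in E | incident v (gamma v a) e && (v \notin e))
          qpath v (gamma v a) e.
Definition Nv (v : T) : int := \sum_(a in Ann) xva v a.
Definition Minv : int := - \sum_(v in V :|: A0) Nv v * ((valency v)%:Z - 2).
Definition pue (u : T) (e : {set T}) : int :=
  \sum_(a in Ann | e \in pedges u (gamma u a)) xhat u a.
Definition edge_of (a : T) : {set T} := odflt set0 [pick e in E | a \in e].
Definition Fa (a : T) : int := gcdz (f a) (pue a (edge_of a)).
Definition FT : int := \sum_(a in Ann) Fa a.
Definition genus : rat := (2 - Minv%:~R - FT%:~R) / 2.
Definition deltainv : rat := (FT%:~R - Minv%:~R) / 2.

Definition Qp (x : T) (s : seq T) (u : T) : int :=
  \prod_(e in E | (u \in e) && (e \notin pedges x s)) q e u.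
(* product over the interior cells x_1, ..., x_{n-1} *)
Definition Qstar (x : T) (s : seq T) : int :=
  \prod_(u <- behead (belast x s)) Qp x s u.
Definition Iv (X Y : {set T}) : int :=
  \sum_(a in X) \sum_(b in Y | a != b) Qstar a (gamma a b) * f a * f b.
Definition frakM (X : {set T}) : rat :=
  \sum_(a in X) (1 - ((f a)%:~R)^-1) * (Iv [set a] (Ann :\: X))%:~R.

Definition pseudo_root (v0 : T) : Prop :=
  [/\ v0 \in V,
      (forall e, e \in E -> v0 \in e -> q e v0 = 1) &
      (forall v, v \in V -> v != v0 ->
         #|[set e in E | [&& v \in e, e \notin pedges v0 (gamma v0 v)
                           & q e v != 1]]| <= 1)%N].

(* The tree T_X, built on cells T + T: inl x is the old cell x,
   inr v is the new arrow alpha_v. *)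
Section TX.
Variables (v0 : T) (X : {set T}).
Definition onpathX (x : T) : bool := [exists a in X, x \in v0 :: gamma v0 a].
Definition VX : {set T} := [set v in V | onpathX v].
Definition EX : {set {set T}} :=
  [set e in E | [exists a in X, e \in pedges v0 (gamma v0 a)]].
Definition bv (v : T) : int :=
  \prod_(e in E | (v \in e) && (e \notin EX)) q e v.
Definition newV : {set T} := [set v in VX | bv v != 1].
Definition TX : dtree (T + T)%type :=
  DTree [set inl v | v in VX]
        ([set inl a | a in X] :|: [set inr v | v in newV])
        ([set [set @inl T T y | y in (e : {set T})] | e in EX]
           :|: [set [set @inl T T v; inr v] | v in newV])
        (fun c => match c with inl x => f x | inr _ => 0 end)
        (fun e c => match c with
                    | inl x => if (x \in newV) && (e == [set inl x; inr x])
                               then bv x else q [set y | inl y \in e] x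
                    | inr _ => 1 end).
End TX.
End Basic.

Section Frak.
Variables (T : finType) (t : dtree T) (v0 : T).
Definition FX (X : {set T}) (a : T) : int := Fa (TX t v0 X) (inl a).
Definition frakD (X : {set T}) : rat :=
  frakM t X / 2 - (\sum_(a in X) (Fa t a - FX X a)%:~R) / 2.
Definition frakG (X : {set T}) : rat :=
  frakM t X / 2 + (\sum_(a in X) (Fa t a - FX X a)%:~R) / 2.
End Frak.

(* Main.v *)
Require Import Defs.
From HB Require Import structures.
From mathcomp Require Import all_boot all_order all_algebra.
From mathcomp Require Import zify ring.
From Stdlib Require Import ClassicalEpsilon.
Set Implicit Arguments. Unset Strict Implicit. Unset Printing Implicit Defensive.
Import Order.TTheory GRing.Theory Num.Theory.
Local Open Scope ring_scope.

(** The terms in F cancel, so only M matters.  Fix an arrow [a] and root the tree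
at [a]; for [v <> a] let [e_v] be the edge at [v] leading to [a], and let [P v] be
the product of the decorations incident to the path from [v] to [a] at its cells
other than [v].  Then [x_{v,a} = f(a) * P v * prod_(e at v, e <> e_v) q(e,v)], and
summing [x_{v,a} * (valency v - 2)] over all cells [v <> a] telescopes along the
edges: it leaves [-1] plus the sum of [P v * (defect v + 1)], where the defect of
[v] depends only on the decorations near [v] of the edges other than [e_v].

The defect is [-1] when at most one of these decorations differs from [1]; by
pseudo-rootedness this is the case off the tree T_X.  It does not change either
when a set of edges with at most one nontrivial decoration is replaced by a single
edge carrying their product, which is what T_X does at its vertices.  So the sum
is the same in T and T_X, and the two invariants M differ only by the terms of the
arrows outside X, whose valency is [1] and which yield the numbers Q*. *)

(** * Big operators and images over finite sets *)

Lemma big_setU_disjoint (R : Type) (idx : R) (op : Monoid.com_law idx)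
    (I : finType) (A B : {set I}) (F : I -> R) : [disjoint A & B] ->
  \big[op/idx]_(e in A :|: B) F e =
    op (\big[op/idx]_(e in A) F e) (\big[op/idx]_(e in B) F e).
Proof.
move=> dAB; rewrite (eq_bigl [predU A & B]); last by move=> e; rewrite !inE.
exact: bigU.
Qed.

Lemma imset_setD1 (I J : finType) (h : I -> J) (S : {set I}) (e : I) :
  injective h -> h @: S :\ h e = h @: (S :\ e).
Proof.
move=> hinj; apply/setP => j; apply/setD1P/imsetP => [[nj /imsetP[i iS jE]]|[i]].
  by exists i; rewrite // !inE iS andbT; apply: contraNneq nj => <-; rewrite jE.
rewrite !inE => /andP[ie iS] ->; split; last exact: imset_f.
by rewrite (inj_eq hinj).
Qed.

(** * The defect of a finite set of weights *)

Section DefectSum.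
Variables (I : finType).
Implicit Types (S : {set I}) (w : I -> int).

(** For nonzero weights this is [prod w * (#|S| - 1 - sum 1/w)]; omitting factors instead of
    dividing keeps it an integer and allows zero weights. At a cell other than the root, [#|S| - 1]
    will be the valency minus 2. *)
Definition defect S w : int :=
  (#|S|%:Z - 1) * \prod_(e in S) w e
  - \sum_(e in S) \prod_(e' in S :\ e) w e'.

Lemma defect0 w : defect set0 w = -1.
Proof. by rewrite /defect cards0 !big_set0 subr0 mulr1 sub0r. Qed.

Lemma defect1 s w : defect [set s] w = -1.
Proof.
by rewrite /defect cards1 subrr mul0r sub0r big_set1 setDv big_set0.
Qed.

Lemma eq_in_defect S w w' : {in S, w =1 w'} -> defect S w = defect S w'.
Proof.
move=> eqw; rewrite /defect; congr (_ * _ - _); first exact: eq_bigr.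
apply: eq_bigr => e _; apply: eq_bigr => e'; rewrite in_setD1 => /andP[_].
exact: eqw.
Qed.

(** Split the sum by the set that contains the omitted element. Since [S2] enters only through its
    product and its defect, it can be traded for another set with the same two values. *)
Lemma defectU S1 S2 w : [disjoint S1 & S2] ->
  defect (S1 :|: S2) w = (\prod_(e in S2) w e) * defect S1 w
    + (\prod_(e in S1) w e) * (defect S2 w + \prod_(e in S2) w e).
Proof.
move=> dis; rewrite /defect cardsU disjoint_setI0 // cards0 subn0.
rewrite big_setU_disjoint //=.
have -> : \sum_(e in S1 :|: S2) \prod_(e' in (S1 :|: S2) :\ e) w e'
  = (\prod_(e in S2) w e) * (\sum_(e in S1) \prod_(e' in S1 :\ e) w e')
   + (\prod_(e in S1) w e) * (\sum_(e in S2) \prod_(e' in S2 :\ e) w e').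
  rewrite big_setU_disjoint //=.
  rewrite !mulr_sumr; congr (_ + _); apply: eq_bigr => e eS.
    rewrite setDUl big_setU_disjoint;
      last exact: disjointW (subD1set _ _) (subD1set _ _) dis.
    rewrite mulrC (_ : S2 :\ e = S2) //.
    by apply/setDidPl; rewrite disjoint_sym disjoints1 (disjointFr dis eS).
  rewrite setDUl big_setU_disjoint;
      last exact: disjointW (subD1set _ _) (subD1set _ _) dis.
  rewrite (_ : S1 :\ e = S1) //.
  by apply/setDidPl; rewrite disjoint_sym disjoints1 (disjointFl dis eS).
by rewrite PoszD; ring.
Qed.

Lemma defect_triv S w : {in S, forall e, w e = 1} -> defect S w = -1.
Proof.
move=> w1; rewrite /defect big1 // mulr1 (eq_bigr (fun=> 1)); last first.
  by move=> e _; rewrite big1 // => e'; rewrite in_setD1 => /andP[_ /w1].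
by rewrite sumr_const; ring.
Qed.

(** Split off the exceptional element [s]: both parts have defect -1 and the other weights have
    product 1, so [defectU] gives [-1 + w s * (-1 + 1)]. *)
Lemma defect_le1 S w : (#|[set e in S | w e != 1]| <= 1)%N -> defect S w = -1.
Proof.
rewrite leq_eqVlt ltnS leqn0 cards_eq0 => /orP[/cards1P[s sE]|/eqP S0].
  have sS : s \in S.
    by have := set11 s; rewrite -sE inE => /andP[].
  rewrite -(setD1K sS) defectU; last by rewrite disjoints1 !inE eqxx.
  have triv : {in S :\ s, forall e, w e = 1}.
    move=> e; rewrite in_setD1 => /andP[es eS]; apply/eqP/negPn.
    apply: contra es => we; have : e \in [set s] by rewrite -sE inE eS.
    by rewrite inE.
  by rewrite defect1 defect_triv // big_set1 big1 //; ring.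
apply: defect_triv => e eS; apply/eqP/negPn/negP => we.
by move/setP/(_ e): S0; rewrite !inE eS we.
Qed.

End DefectSum.

Lemma defect_imset (I J : finType) (h : I -> J) (S : {set I}) (w : J -> int) :
  injective h -> defect (h @: S) w = defect S (w \o h).
Proof.
move=> hinj; rewrite /defect card_imset // !big_imset /=; try by move=> *; apply: hinj.
congr (_ - _); apply: eq_bigr => e eS.
rewrite imset_setD1 //.
by rewrite big_imset //; move=> *; apply: hinj.
Qed.

(** * Trees rooted by a parent function, and their paths to the root *)

Section Rooted.
Variables (T : finType) (t : dtree T).

(** By convention the root is its own parent. The depth drops by one at every other step, so each
    cell reaches the root; in [edge_par] the cell [x] will be called the lower end of [e]. *)
Record rooted (r : T) (par : T -> T) (dep : T -> nat) : Prop := Rooted {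
  root_cell : r \in cells t;
  par_root : par r = r;
  dep_root : dep r = 0%N;
  par_cell : forall x, x \in cells t -> par x \in cells t;
  depS : forall x, x \in cells t -> x != r -> dep x = (dep (par x)).+1;
  par_edge : forall x, x \in cells t -> x != r -> [set x; par x] \in dE t;
  edge_par : forall e, e \in dE t ->
    exists x, [/\ x \in cells t, x != r & e = [set x; par x]] }.

Variables (r : T) (par : T -> T) (dep : T -> nat).
Hypothesis rt : rooted r par dep.
Local Notation cells := (cells t).

(** The tail of the path from [x] to the root, in the format of [gamma]: [x] itself is left out. *)
Definition ancestors (x : T) : seq T := traject par (par x) (dep x).

Lemma dep_eq0 x : x \in cells -> (dep x == 0%N) = (x == r).
Proof.
move=> xC; apply/idP/idP => [|/eqP->]; last by rewrite (dep_root rt).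
by apply: contraLR => xr; rewrite (depS rt).
Qed.

Lemma par_neq x : x \in cells -> x != r -> par x != x.
Proof.
by move=> xC xr; apply/eqP => px; have := depS rt xC xr; rewrite px; lia.
Qed.

Lemma up_par x : x \in cells -> x != r -> ancestors x = par x :: ancestors (par x).
Proof. by move=> xC xr; rewrite /ancestors (depS rt xC xr) trajectS. Qed.

Lemma up_root : ancestors r = [::].
Proof. by rewrite /ancestors (dep_root rt). Qed.

Lemma up_ind (Q : T -> Prop) :
  Q r -> (forall x, x \in cells -> x != r -> Q (par x) -> Q x) ->
  forall x, x \in cells -> Q x.
Proof.
move=> Qr QS x; move: {2}(dep x) (erefl (dep x)) => n.
elim: n x => [|n IH] x dx xC.
  by have := dep_eq0 xC; rewrite dx eqxx => /esym/eqP->.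
have xr : x != r by rewrite -dep_eq0 // dx.
apply: QS => //; apply: IH; last exact: par_cell rt _ xC.
by have := depS rt xC xr; lia.
Qed.

Lemma last_up x : x \in cells -> last x (ancestors x) = r.
Proof.
elim/up_ind => [|y yC yr IH]; first by rewrite up_root.
by rewrite up_par.
Qed.

Lemma belast_up x : belast x (ancestors x) = traject par x (dep x).
Proof.
rewrite /ancestors; case: (dep x) => // n; elim: n x => //= n IH x.
by rewrite IH.
Qed.

(** Distinct cells sharing this edge would be each other's parents, each deeper than the other. So
    the lower end of an edge is unique. *)
Lemma pedge_inj x y : x \in cells -> y \in cells -> x != r -> y != r ->
  [set x; par x] = [set y; par y] -> x = y.
Proof.
move=> xC yC xr yr eqe; apply/eqP; apply: contraT => xy.
have : x \in [set y; par y] by rewrite -eqe set21.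
rewrite !inE (negPf xy) /= => /eqP xE.
have : y \in [set x; par x] by rewrite eqe set21.
rewrite !inE eq_sym (negPf xy) /= => /eqP yE.
by have := depS rt xC xr; have := depS rt yC yr; rewrite -xE -yE; lia.
Qed.

Lemma mem_up_cell x y : x \in cells -> y \in x :: ancestors x -> y \in cells.
Proof.
elim/up_ind => [|z zC zr IH].
  by rewrite up_root inE => /eqP->; apply: root_cell rt.
by rewrite up_par // inE => /orP[/eqP->//|]; apply: IH.
Qed.

Lemma dep_le_up x y : x \in cells -> y \in x :: ancestors x -> (dep y <= dep x)%N.
Proof.
elim/up_ind => [|z zC zr IH].
  by rewrite up_root inE => /eqP->.
rewrite up_par // inE => /orP[/eqP->//|/IH].
by have := depS rt zC zr; lia.
Qed.

Lemma root_in_up x : x \in cells -> r \in x :: ancestors x.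
Proof. by move=> xC; rewrite -[X in X \in _](last_up xC) mem_last. Qed.

Lemma mem_up_par x y :
  x \in cells -> y \in x :: ancestors x -> par y \in x :: ancestors x.
Proof.
elim/up_ind => [|z zC zr IH].
  by rewrite up_root inE => /eqP->; rewrite (par_root rt) inE eqxx.
rewrite up_par // inE => /orP[/eqP->|/IH]; first by rewrite !inE eqxx orbT.
by move=> yu; rewrite inE yu orbT.
Qed.

Lemma pedges_up x :
  pedges x (ancestors x) = [seq [set c; par c] | c <- belast x (ancestors x)].
Proof.
rewrite belast_up /pedges /ancestors; move: (dep x) => n.
by elim: n x => //= n IH x; rewrite IH.
Qed.

(** By [pedges_up], [belast x (ancestors x)] lists the lower ends of the edges of the path; among
    its cells only the root is not one. *)
Lemma mem_chain x c : x \in cells ->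
  (c \in belast x (ancestors x)) = (c \in x :: ancestors x) && (c != r).
Proof.
elim/up_ind => [|z zC zr IH].
  by rewrite up_root /= !inE andbN.
rewrite up_par //= !inE; case: (eqVneq c z) => [->//|_] /=.
by rewrite IH inE.
Qed.

Lemma is_path_up x : x \in cells -> is_pathb t x r (ancestors x).
Proof.
elim/up_ind => [|z zC zr].
  by rewrite up_root /is_pathb /= (root_cell rt) eqxx.
rewrite /is_pathb (@up_par z) // => /and4P[aC aE uE lE].
have pC := par_cell rt zC.
rewrite /= -/(pedges (par z) (ancestors (par z))) -/(all _ (par z :: _)) zC aC aE uE lE.
rewrite (par_edge rt) // !andbT /=.
rewrite pedges_up; apply/mapP => -[c].
rewrite mem_chain // => /andP[cu cr] /pedge_inj -/(_ zC) zE.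
have := dep_le_up pC cu; rewrite -zE ?(mem_up_cell pC cu) //.
by have := depS rt zC zr; lia.
Qed.

(* A path that descends one edge can never climb back, as its edges are
   distinct; so it avoids the root. *)
Lemma descending_path x y s : y \in cells -> y != r -> x = par y ->
  all (mem (dE t)) (pedges y s) -> uniq (pedges y s) ->
  [set y; x] \notin pedges y s -> all (mem cells) s -> last y s != r.
Proof.
elim: s x y => [//|z s IH] x y yC yr -> /= /andP[eE aE] /andP[nE uE].
rewrite inE negb_or => /andP[ne nE'] /andP[zC aC].
have [c [cC cr ec]] := edge_par rt eE.
have yc : y != c.
  by apply: contraNneq ne => yE; rewrite ec -yE.
have /eqP yE : y == par c.
  have : y \in [set c; par c] by rewrite -ec set21.
  by rewrite !inE (negPf yc).
have zc : z = c.
  have : c \in [set y; z] by rewrite ec set21.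
  by rewrite !inE eq_sym (negPf yc) /= => /eqP.
apply: (IH y z) => //; rewrite ?zc // setUC -zc; exact: nE.
Qed.

(** Induction along the path. Its first edge goes to the parent of [x] or to a child; in the second
    case [descending_path] shows that the path misses the root. *)
Lemma path_up x s : is_pathb t x r s -> s = ancestors x.
Proof.
elim: s x => [|y s IH] x /and4P[/= /andP[xC aC] aE uE lE].
  by move/eqP: lE => ->; rewrite up_root.
case/andP: aC => yC aC; case/andP: aE => eE aE; case/andP: uE => nE uE.
have [c [cC cr ec]] := edge_par rt eE.
have [cx|cx] := eqVneq c x.
  have yx : y != x.
    apply: contraNneq (par_neq cC cr) => yx.
    have : par c \in [set x; y] by rewrite ec set22.
    by rewrite yx setUid inE cx.
  have yE : y = par x.
    have : y \in [set c; par c] by rewrite -ec set22.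
    by rewrite !inE cx (negPf yx) => /eqP.
  rewrite up_par -?cx // cx -yE; congr (_ :: _); apply: IH.
  by rewrite /is_pathb /= yC aC lE aE uE.
(* Remaining case: the first edge descends from [x] to [y]. *)
have cy : c = y.
  have : c \in [set x; y] by rewrite ec set21.
  by rewrite !inE (negPf cx) => /eqP.
have xE : x = par y.
  have : x \in [set c; par c] by rewrite -ec set21.
  by rewrite !inE eq_sym (negPf cx) cy => /eqP.
have := @descending_path x y s yC.
rewrite -{1}cy cr lE => /(_ isT xE aE uE); rewrite setUC => /(_ nE aC) //.
Qed.

Lemma gamma_up x : x \in cells -> gamma t x r = ancestors x.
Proof.
move=> xC; rewrite /gamma; case: excluded_middle_informative => [H|[]].
  by apply: path_up; apply: (xchooseP H).
by exists (ancestors x); apply: is_path_up.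
Qed.

End Rooted.

(** * Reversing and splitting paths; rooting a tree at a given cell *)

Section Paths.
Variables (T : finType) (t : dtree T).
Implicit Types (x y : T) (s : seq T) (e : {set T}).

Lemma last_rev_belast x s : last (last x s) (rev (belast x s)) = x.
Proof. by case: s => //= y s; rewrite rev_cons last_rcons. Qed.

Lemma pedges_cat x s1 s2 :
  pedges x (s1 ++ s2) = pedges x s1 ++ pedges (last x s1) s2.
Proof. by rewrite /pedges pairmap_cat. Qed.

Lemma pedges_rev x s : pedges (last x s) (rev (belast x s)) = rev (pedges x s).
Proof.
elim: s x => //= y s IH x; rewrite rev_cons -cats1 pedges_cat IH.
by rewrite last_rev_belast /= rev_cons -cats1 setUC.
Qed.

Lemma behead_belast_rev x s :
  behead (belast (last x s) (rev (belast x s))) = rev (behead (belast x s)).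
Proof.
by case: s => //= y s; rewrite rev_cons belast_rcons.
Qed.

Lemma path_rev x y s : is_pathb t x y s -> is_pathb t y x (rev (belast x s)).
Proof.
case/and4P => aC aE uE /eqP <-; rewrite /is_pathb pedges_rev all_rev rev_uniq.
rewrite aE uE last_rev_belast eqxx !andbT.
by rewrite -rev_rcons -lastI all_rev.
Qed.

Lemma path_cat x y s1 s2 : is_pathb t x y (s1 ++ s2) ->
  is_pathb t x (last x s1) s1 /\ is_pathb t (last x s1) y s2.
Proof.
rewrite /is_pathb pedges_cat last_cat -cat_cons !all_cat cat_uniq.
case/and4P => /andP[aC1 aC2] /andP[aE1 aE2] /and3P[u1 _ u2] lE.
rewrite aC1 aE1 u1 eqxx aE2 u2 lE /= aC2 !andbT; split=> //.
exact: (allP aC1 _ (mem_last x s1)).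
Qed.

Lemma mem_pedges e x s : e \in pedges x s ->
  exists s1 w s2, s = s1 ++ w :: s2 /\ e = [set last x s1; w].
Proof.
elim: s x => //= y s IH x; rewrite inE => /orP[/eqP->|/IH].
  by exists [::], y, s.
by move=> [s1 [w [s2 [-> ->]]]]; exists (y :: s1), w, s2.
Qed.

Hypothesis tree : is_tree t.

Lemma gamma_path x y : x \in cells t -> y \in cells t ->
  is_pathb t x y (gamma t x y).
Proof.
move=> xC yC; have [s [sP _]] := tree xC yC.
rewrite /gamma; case: excluded_middle_informative => [H|[]]; last by exists s.
exact: (xchooseP H).
Qed.

Lemma path_cells x y s : is_pathb t x y s -> x \in cells t /\ y \in cells t.
Proof.
case/and4P => aC _ _ /eqP <-; split; first by case/andP: aC.
exact: (allP aC _ (mem_last x s)).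
Qed.

Lemma gamma_uniq x y s : is_pathb t x y s -> gamma t x y = s.
Proof.
move=> sP; have [xC yC] := path_cells sP.
have [s' [_ uni]] := tree xC yC.
by rewrite -(uni _ sP); apply/esym/uni/gamma_path.
Qed.

Lemma gamma_rev x y : x \in cells t -> y \in cells t ->
  gamma t y x = rev (belast x (gamma t x y)).
Proof. by move=> xC yC; apply/gamma_uniq/path_rev/gamma_path. Qed.

Lemma mem_pedges_gammaC x y : x \in cells t -> y \in cells t ->
  pedges y (gamma t y x) =i pedges x (gamma t x y).
Proof.
move=> xC yC e; rewrite (gamma_rev xC yC).
have /and4P[_ _ _ /eqP lE] := gamma_path xC yC.
by rewrite -[X in pedges X]lE pedges_rev mem_rev.
Qed.

Lemma mem_gammaC x y : x \in cells t -> y \in cells t ->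
  y :: gamma t y x =i x :: gamma t x y.
Proof.
move=> xC yC z; rewrite (gamma_rev xC yC).
have /and4P[_ _ _ /eqP lE] := gamma_path xC yC.
by rewrite -[X in X :: _]lE -rev_rcons -lastI mem_rev.
Qed.

(** Reversing a path permutes its interior cells and keeps its set of edges. *)
Lemma Qstar_sym x y : x \in cells t -> y \in cells t ->
  Qstar t x (gamma t x y) = Qstar t y (gamma t y x).
Proof.
move=> xC yC; rewrite /Qstar (gamma_rev xC yC).
have /and4P[_ _ _ /eqP lE] := gamma_path xC yC.
have -> : behead (belast y (rev (belast x (gamma t x y))))
    = rev (behead (belast x (gamma t x y))).
  by rewrite -[X in belast X]lE behead_belast_rev.
rewrite [RHS](perm_big _ (permEl (perm_rev _))); apply: eq_bigr => u _.
rewrite /Qp; apply: eq_bigl => e.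
by rewrite -(gamma_rev xC yC) mem_pedges_gammaC.
Qed.

Hypothesis edges2 : forall e, e \in dE t -> (e \subset cells t) && (#|e| == 2).

Lemma path0 x s : is_pathb t x x s -> s = [::].
Proof.
move=> sP; have [xC _] := path_cells sP.
rewrite -(gamma_uniq sP); apply: gamma_uniq.
by rewrite /is_pathb /= xC eqxx.
Qed.

(** If the edge is not in the path from [y], prepending it gives the path from [x]. Otherwise it
    must be the first edge of the path from [y], because a nonempty initial piece would return to
    [y]. *)
Lemma gamma_edge r x y : r \in cells t -> x \in cells t -> y \in cells t ->
  x != y -> [set x; y] \in dE t ->
  gamma t x r = y :: gamma t y r \/ gamma t y r = x :: gamma t x r.
Proof.
move=> rC xC yC xy eE.
have yP := gamma_path yC rC.
have [|nE] := boolP ([set x; y] \in pedges y (gamma t y r)); last first.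
  left; apply: gamma_uniq; move: yP => /and4P[aC aE uE lE].
  by rewrite /is_pathb /= xC eE lE aE uE -[_ && all _ _]/(all _ (_ :: _)) aC nE.
case/mem_pedges => s1 [w [s2 [gE eqe]]]; right; rewrite gE in yP *.
have [p1 p2] := path_cat yP.
have : y \in [set last y s1; w] by rewrite -eqe set22.
rewrite !inE => /orP[/eqP yl|/eqP yw]; last first.
  rewrite -cat_rcons -yw in yP; have [+ _] := path_cat yP.
  by rewrite last_rcons => /path0; case: (s1).
rewrite -yl in p1 p2; have s0 := path0 p1; rewrite s0 /= in gE eqe *.
have wx : x = w.
  have : x \in [set y; w] by rewrite -eqe set21.
  by rewrite !inE (negPf xy) => /eqP.
rewrite -wx in p2 *; congr (_ :: _); apply/esym/gamma_uniq.
by have [_] := @path_cat y r [:: x] s2 p2.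
Qed.

(** The parent is the first step of the path to [r] and the depth is its length; [gamma_edge]
    provides the lower end of each edge. *)
Lemma tree_rooted r : r \in cells t -> exists par dep, rooted t r par dep.
Proof.
(* The path from [r] is empty, so the default value of [head] makes [r] its own parent. *)
move=> rC; exists (fun x => head r (gamma t x r)), (fun x => size (gamma t x r)).
have g0 : gamma t r r = [::] by apply: gamma_uniq; rewrite /is_pathb /= rC eqxx.
have gS x : x \in cells t -> x != r ->
    exists y, [/\ y \in cells t, [set x; y] \in dE t &
                  gamma t x r = y :: gamma t y r].
  move=> xC xr; have := gamma_path xC rC.
  case gE: (gamma t x r) => [|y s]; first by case/and4P => _ _ _; rewrite (negPf xr).
  move=> gP; exists y; have [_ yP] := @path_cat x r [:: y] s gP.
  have [yC _] := path_cells yP; split=> //; last by rewrite (gamma_uniq yP).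
  by case/and4P: gP => _ /andP[].
split=> //.
- by rewrite g0.
- by rewrite g0.
- move=> x xC; have [->|xr] := eqVneq x r; first by rewrite g0.
  by have [y [yC _ ->]] := gS _ xC xr.
- by move=> x xC xr; have [y [yC _ ->]] := gS _ xC xr.
- by move=> x xC xr; have [y [yC eE ->]] := gS _ xC xr.
move=> e eE; have /andP[eC /cards2P[x [y [xy eqe]]]] := edges2 eE.
have xC : x \in cells t by apply: (subsetP eC); rewrite eqe set21.
have yC : y \in cells t by apply: (subsetP eC); rewrite eqe set22.
rewrite eqe in eE *; have [gE|gE] := gamma_edge rC xC yC xy eE.
  by exists x; rewrite gE; split=> //; apply: contraPneq gE => ->; rewrite g0.
exists y; rewrite gE setUC; split=> //.
by apply: contraPneq gE => ->; rewrite g0.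
Qed.

End Paths.

(** * Products along paths to the root, and the telescoping sum *)

Section RootedSums.
Variables (T : finType) (t : dtree T) (r : T) (par : T -> T) (dep : T -> nat).
Hypothesis rt : rooted t r par dep.
Local Notation cells := (cells t).
Local Notation q := (dq t).
Local Notation up := (ancestors par dep).

(* At the root, [set x; par x] is a singleton, hence not an edge. *)
Definition off_edges (x : T) : {set {set T}} := edges_at t x :\ [set x; par x].
(** The factor contributed at [par c] by a path to the root that arrives there from [c]. *)
Definition sideprod (c : T) : int :=
  \prod_(e in off_edges (par c) :\ [set c; par c]) q e (par c).
(** This is the product [P x]: the cells of the path after [x] are the parents of the cells in
    [belast]. *)
Definition chainprod (x : T) : int := \prod_(c <- belast x (up x)) sideprod c.

Lemma chainprod_root : chainprod r = 1.
Proof. by rewrite /chainprod (up_root rt) big_nil. Qed.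

Lemma chainprod_par x : x \in cells -> x != r ->
  chainprod x = sideprod x * chainprod (par x).
Proof. by move=> xC xr; rewrite /chainprod (up_par rt xC xr) /= big_cons. Qed.

(** The depth drops by one at each step, so a cell of the path is determined by its depth. In
    [Qp_par] this identifies the cell from which the path enters [par c]. *)
Lemma up_dep_inj v x y : v \in cells -> x \in v :: up v -> y \in v :: up v ->
  dep x = dep y -> x = y.
Proof.
move=> vC; elim/(up_ind rt): v / vC => [|z zC zr IH].
  by rewrite (up_root rt) !inE => /eqP-> /eqP->.
have pC := par_cell rt zC; have dz := depS rt zC zr.
rewrite (up_par rt zC zr) inE [y \in _]inE.
case/orP=> [/eqP->|xu]; case/orP=> [/eqP->|yu] // dE.
- by have := dep_le_up rt pC yu; lia.
- by have := dep_le_up rt pC xu; lia.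
- exact: IH.
Qed.

Lemma uniq_up v : v \in cells -> uniq (v :: up v).
Proof.
elim/(up_ind rt) => [|z zC zr IH]; first by rewrite (up_root rt).
rewrite (up_par rt zC zr) cons_uniq IH andbT; apply/negP => zu.
have := dep_le_up rt (par_cell rt zC) zu.
by have := depS rt zC zr; lia.
Qed.

Lemma root_edgeN : [set r; par r] \notin dE t.
Proof.
apply/negP => /(edge_par rt)[c [cC cr]]; rewrite (par_root rt) setUid => eqe.
have : c \in [set r] by rewrite eqe set21.
by rewrite inE (negPf cr).
Qed.

Lemma Qp_start v : v \in cells ->
  Qp t v (up v) v = \prod_(e in off_edges v) q e v.
Proof.
move=> vC; apply: eq_bigl => e; rewrite !inE.
case eE: (e \in dE t); last by rewrite /= !andbF.
case ve: (v \in e); last by rewrite /= !andbF.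
rewrite /= andbT; congr (~~ _); apply/idP/eqP => [|eqe].
  rewrite pedges_up => /mapP[c]; rewrite (mem_chain rt) // => /andP[cu cr] eqe.
  have cC := mem_up_cell rt vC cu.
  rewrite eqe !inE in ve; case/orP: ve => [/eqP->//|/eqP vE].
  have := dep_le_up rt vC cu; have := depS rt cC cr; rewrite -vE; lia.
rewrite pedges_up eqe; apply/mapP; exists v => //.
rewrite (mem_chain rt) // mem_head /=.
by apply: contraNneq root_edgeN => <-; rewrite -eqe.
Qed.

(** At [par c] the path uses only the edge from [c] and, unless [par c] is the root, the edge to the
    next parent. *)
Lemma Qp_par v c : v \in cells -> c \in belast v (up v) ->
  Qp t v (up v) (par c) = sideprod c.
Proof.
move=> vC cb; move: (cb); rewrite (mem_chain rt) // => /andP[cu cr].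
have cC := mem_up_cell rt vC cu.
apply: eq_bigl => e; rewrite !inE.
case eE: (e \in dE t); last by rewrite !andbF.
case pe: (par c \in e); last by rewrite !andbF.
rewrite /= andbT -negb_or; congr (~~ _).
rewrite pedges_up; apply/mapP/orP => [[d db eqe]|[] /eqP eqe]; last 2 first.
- by exists c.
- exists (par c) => //; rewrite (mem_chain rt) // (mem_up_par rt) //=.
  by apply: contraNneq root_edgeN => <-; rewrite -eqe.
move: db; rewrite (mem_chain rt) // => /andP[du dr].
have dC := mem_up_cell rt vC du.
rewrite eqe !inE in pe; case/orP: pe => [/eqP pd|/eqP pd].
  by right; rewrite eqe pd.
left; rewrite eqe (_ : d = c) //; apply: (up_dep_inj vC) => //.
by rewrite (depS rt cC cr) (depS rt dC dr) pd.
Qed.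

Lemma up_map v : up v = map par (belast v (up v)).
Proof.
rewrite belast_up /ancestors; move: (dep v) => n.
by elim: n v => //= n IH v; rewrite IH.
Qed.

Lemma prod_Qp_up v : v \in cells ->
  \prod_(u <- up v) Qp t v (up v) u = chainprod v.
Proof.
move=> vC; rewrite {1}up_map big_map /chainprod; apply: eq_big_seq => c.
exact: Qp_par.
Qed.

(** An incident edge meets the path only in its upper end: if its lower end were on the path, the
    edge would be too. Hence grouping the incident edges by cells counts each of them once. *)
Lemma prod_incident v : v \in cells ->
  \prod_(e in dE t | incident t v (up v) e) qpath t v (up v) e
  = \prod_(u <- v :: up v) Qp t v (up v) u.
Proof.
move=> vC; rewrite /Qp.
rewrite (exchange_big_dep (fun e => (e \in dE t) && (e \notin pedges v (up v))))
  /=; last by move=> u e _ /and3P[-> _ ->].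
rewrite (eq_bigl (fun e => ((e \in dE t) && (e \notin pedges v (up v)))
    && has (fun u => u \in e) (v :: up v))); last first.
  by move=> e; rewrite /incident -andbA andbA andbb andbA.
rewrite big_mkcondr /=; apply: eq_bigr => e /andP[eE ne].
rewrite /qpath (eq_bigl (fun u => u \in e)); last first.
  by move=> u; rewrite eE ne andbT.
rewrite -big_filter -[_ || _]/(has (fun u => u \in e) (v :: up v)) has_filter.
have [c [cC cr eqe]] := edge_par rt eE.
have cu : c \notin v :: up v.
  apply: contra ne => cu; rewrite pedges_up eqe; apply: map_f.
  by rewrite (mem_chain rt) // cu.
have -> : [seq u <- v :: up v | u \in e] = [seq u <- v :: up v | pred1 (par c) u].
  apply: eq_in_filter => u uu; rewrite eqe !inE /=.
  by have [uc|//] := eqVneq u c; rewrite uc (negPf cu) in uu.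
have [pu|pu] := boolP (par c \in v :: up v).
  by rewrite filter_pred1_uniq ?uniq_up //= big_seq1.
have -> : [seq u <- v :: up v | pred1 (par c) u] = [::].
  apply/eqP; rewrite -[_ == _]negbK -has_filter; apply/hasPn => u uu /=.
  by apply: contraNneq pu => <-.
by rewrite big_nil.
Qed.

Lemma xva_chainprod v : v \in cells ->
  xva t v r = df t r * (chainprod v * \prod_(e in off_edges v) q e v).
Proof.
move=> vC; rewrite /xva (gamma_up rt vC) prod_incident // big_cons.
by rewrite Qp_start // prod_Qp_up //; congr (_ * _); rewrite mulrC.
Qed.

(** An edge at [v] other than the one to the parent has [v] as its upper end, so sums over such
    edges become sums over children. *)
Lemma off_edges_children v : v \in cells ->
  off_edges v = [set [set c; par c] | c in [set c in cells :\ r | par c == v]].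
Proof.
move=> vC; apply/setP => e; apply/idP/imsetP => [|[c]].
  rewrite !inE => /and3P[ne eE ve]; have [c [cC cr eqe]] := edge_par rt eE.
  exists c => //; rewrite inE in_setD1 cC cr /=.
  rewrite eqe !inE in ve; case/orP: ve => [/eqP vc|/eqP->//].
  by rewrite eqe vc eqxx in ne.
rewrite inE in_setD1 => /andP[/andP[cr cC] /eqP pc] ->.
rewrite in_setD1 inE (par_edge rt) // -{3}pc set22 !andbT.
apply: contraNneq root_edgeN => eqe.
have [vr|vr] := eqVneq v r; first by rewrite -vr -eqe (par_edge rt).
have cv := pedge_inj rt cC vC cr vr eqe.
by have := par_neq rt cC cr; rewrite pc cv eqxx.
Qed.

Lemma pedge_in v : v \in cells -> v != r -> [set v; par v] \in edges_at t v.
Proof. by move=> vC vr; rewrite inE (par_edge rt) // !inE eqxx. Qed.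

Lemma valency_others v : v \in cells -> v != r ->
  valency t v = #|off_edges v|.+1.
Proof.
by move=> vC vr; rewrite /valency (cardsD1 [set v; par v]) pedge_in.
Qed.

Lemma off_edges_arrow b : b \in cells -> b != r -> valency t b = 1%N ->
  off_edges b = set0.
Proof.
move=> bC br; rewrite valency_others // => -[/eqP].
by rewrite cards_eq0 => /eqP.
Qed.

Hypothesis r1 : valency t r = 1%N.

Lemma sideprod_root c : c \in cells -> c != r -> par c = r -> sideprod c = 1.
Proof.
move=> cC cr pc; rewrite /sideprod pc.
have eE : [set c; r] \in edges_at t r by rewrite inE -{1}pc (par_edge rt) // set22.
move/eqP: r1 => /cards1P[e0 eqe]; rewrite /off_edges.
have -> : edges_at t r :\ [set r; par r] :\ [set c; r] = set0; last by rewrite big_set0.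
apply/setP => e; rewrite !inE; apply/negP => /and3P[n1 _ h].
have {h} : e \in edges_at t r by rewrite inE.
move: eE; rewrite eqe !inE => /eqP ec /eqP ee.
by rewrite ee ec eqxx in n1.
Qed.

(** [chainprod] also counts the final cell, but the root has valency 1 and contributes the factor
    1. *)
Lemma Qstar_chainprod b : b \in cells -> b != r ->
  Qstar t b (gamma t b r) = chainprod b.
Proof.
move=> bC br; rewrite -prod_Qp_up // (gamma_up rt bC) /Qstar.
have upE := up_par rt bC br; have lE := last_up rt bC.
have Qr : Qp t b (up b) r = 1.
  have /mapP[c cb rc] : r \in map par (belast b (up b)).
    by rewrite -up_map -[X in X \in _]lE upE /= mem_last.
  move: (cb); rewrite (mem_chain rt) // => /andP[cu cr].
  rewrite rc Qp_par // sideprod_root //; exact: (mem_up_cell rt bC cu).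
rewrite upE /= in lE Qr *.
by move: (Qp t b _) Qr => F Fr; rewrite [in RHS]lastI big_rcons /= lE Fr mulr1.
Qed.

(** By the definition of the defect, the term of [v] is [chainprod v * (defect + 1)], minus
    [chainprod v], plus the products with one factor omitted. Omitting the edge to a child [c] turns
    [chainprod v] into [chainprod c], so the last two contributions telescope. *)
Lemma chainprod_telescope :
  \sum_(v in cells :\ r) chainprod v * (\prod_(e in off_edges v) q e v)
     * ((valency t v)%:Z - 2)
  = -1 + \sum_(v in cells :\ r) chainprod v * (defect (off_edges v) (q^~ v) + 1).
Proof.
pose ch v := [set c in cells :\ r | par c == v].
have chP v c : c \in ch v -> [/\ c \in cells, c != r & par c = v].
  by rewrite inE in_setD1 => /andP[/andP[-> ->] /eqP].
have ch_inj v : {in ch v &, injective (fun c => [set c; par c])}.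
  by move=> c d /chP[cC cr _] /chP[dC dr _]; apply: (pedge_inj rt).
have step v : v \in cells :\ r ->
    chainprod v * (\prod_(e in off_edges v) q e v) * ((valency t v)%:Z - 2)
    = chainprod v * (defect (off_edges v) (q^~ v) + 1)
      + (\sum_(c in ch v) chainprod c - chainprod v).
  rewrite in_setD1 => /andP[vr vC]; rewrite valency_others //.
  have -> : \sum_(c in ch v) chainprod c
     = chainprod v * \sum_(e in off_edges v) \prod_(e' in off_edges v :\ e) q e' v.
    rewrite mulr_sumr [in RHS]off_edges_children // big_imset; last exact: ch_inj.
    apply: eq_bigr => c /chP[cC cr pc]; rewrite chainprod_par // mulrC pc.
    by rewrite /sideprod pc -[in RHS]off_edges_children.
  by rewrite /defect -addn1 PoszD; ring.
rewrite (eq_bigr _ step) big_split /= [LHS]addrC; congr (_ + _).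
rewrite big_split /= sumrN.
rewrite (exchange_big_dep (fun c => (c \in cells :\ r) && (par c != r))) /=;
  last first.
  by move=> v c; rewrite in_setD1 [c \in ch v]inE => /andP[vr _] /andP[-> /eqP->].
(* The root is not among the [v] summed over, so its children are not compensated. It has a single
   child, whose [chainprod] is 1; this leaves the term -1. *)
have r1' : #|ch r| = 1%N.
  rewrite -r1 /valency (cardsD1 [set r; par r]) [_ \in edges_at _ _]inE.
  by rewrite (negPf root_edgeN) -/(off_edges r) (off_edges_children (root_cell rt))
    card_in_imset //; apply: ch_inj.
rewrite [X in _ - X](bigID (fun c => par c == r)) /=.
have -> : \sum_(c in cells :\ r | par c == r) chainprod c = 1.
  move/eqP/cards1P: r1' => [c0 chE].
  rewrite (eq_bigl (fun c => c \in ch r)); last by move=> c; rewrite [in RHS]inE.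
  rewrite chE big_set1; have /chP[cC cr pc] : c0 \in ch r by rewrite chE set11.
  by rewrite chainprod_par // sideprod_root // pc chainprod_root.
have -> : \sum_(c in cells :\ r | par c != r)
     \sum_(v in cells :\ r | c \in ch v) chainprod c
   = \sum_(c in cells :\ r | par c != r) chainprod c.
  apply: eq_bigr => c /andP[cC pr]; move: (cC); rewrite in_setD1 => /andP[cr cC'].
  rewrite (eq_bigl (pred1 (par c))) ?big_pred1_eq // => v.
  rewrite [c \in ch v]inE !in_setD1 cr cC' /=.
  have [<-|_] := eqVneq (par c) v; last by rewrite andbF.
  by rewrite andbT pr (par_cell rt).
by ring.
Qed.

Hypothesis disj : [disjoint dV t & dA t].
Hypothesis rA : r \in Ann t.
Hypothesis Ann1 : forall a, a \in Ann t -> valency t a = 1%N.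

(** The telescoped sum runs over all cells but [r]. The arrows in [Ann t] must be taken out of it:
    their valency is 1, so each contributes [- chainprod b]. *)
Lemma sum_xva :
  \sum_(v in dV t :|: A0 t) xva t v r * ((valency t v)%:Z - 2)
  = df t r * (-1
     + \sum_(v in cells :\ r) chainprod v * (defect (off_edges v) (q^~ v) + 1)
     + \sum_(b in Ann t :\ r) chainprod b).
Proof.
rewrite -chainprod_telescope [X in _ * (X + _)](bigID (fun v => v \in Ann t)) /=.
have AC b : b \in Ann t -> b \in cells by rewrite !inE => /andP[_ ->]; rewrite orbT.
have -> : \sum_(v in cells :\ r | v \in Ann t)
     chainprod v * (\prod_(e in off_edges v) q e v) * ((valency t v)%:Z - 2)
   = - \sum_(b in Ann t :\ r) chainprod b.
  rewrite -sumrN; apply: eq_big => [v|v /andP[]].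
    rewrite [in RHS]in_setD1 in_setD1 -andbA; congr (_ && _).
    by case vA: (v \in Ann t); rewrite ?andbF // AC.
  rewrite in_setD1 => /andP[vr vC] vA.
  by rewrite off_edges_arrow ?Ann1 // big_set0; ring.
rewrite addrAC addNr add0r mulr_sumr; apply: eq_big => [v|v].
  rewrite !inE; have [->|vr] := eqVneq v r.
    move: rA; rewrite !inE => /andP[/negPf-> /(disjointFl disj)->] //.
  case vV: (v \in dV t); first by rewrite (disjointFr disj vV) andbF.
  by case: (v \in dA t); rewrite //= ?andbT ?negbK.
move=> vV; rewrite xva_chainprod ?mulrA //.
move: vV; rewrite !inE => /orP[->//|/andP[-> _]]; exact: orbT.
Qed.

End RootedSums.

(** * Comparison of two rootings of the same tree *)

Lemma straight_or_reversed (T : finType) (t : dtree T) r r' par par' dep dep' x :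
  rooted t r par dep -> rooted t r' par' dep' -> x \in cells t -> x != r ->
  (x != r' /\ par' x = par x) \/ (par x != r' /\ par' (par x) = x).
Proof.
(* In the second rooting the edge from [x] to its parent has [x] or [par x] as its lower end. *)
move=> rt rt' xC xr; have [y [yC yr' eqe]] := edge_par rt' (par_edge rt xC xr).
have px := par_neq rt xC xr; have py := par_neq rt' yC yr'.
have : x \in [set y; par' y] by rewrite -eqe set21.
rewrite !inE => /orP[] /eqP xE.
  left; rewrite xE; split=> //.
  have : par x \in [set y; par' y] by rewrite -eqe set22.
  by rewrite -xE !inE (negPf px) /= => /eqP->.
have : y \in [set x; par x] by rewrite eqe set21.
by rewrite !inE [X in y == X]xE eq_sym (negPf py) /= => /eqP <-; right.
Qed.

Section Reroot.
Variables (T : finType) (t : dtree T) (v0 a : T).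
Variables (par0 para : T -> T) (dep0 depa : T -> nat).
Hypotheses (rt0 : rooted t v0 par0 dep0) (rta : rooted t a para depa).

(** Only edges between [a] and [v0] change direction. By induction on the distance to [a]: if the
    edge above [x] is reversed, so is the one from [para x] to [x]; thus [para x] lies on the path
    from [a] to [v0], and so does its successor [x]. *)
Lemma reversed_on_chain x : x \in cells t -> par0 x != a -> x != v0 ->
  para (par0 x) = x -> x \in a :: ancestors par0 dep0 a.
Proof.
elim/(up_ind rta) => [|y yC ya IH]; first by rewrite mem_head.
move=> p0a yv0 rev_y; have dy := depS rta yC ya.
have [[_ pE]|[pv0 pE]] := straight_or_reversed rta rt0 yC ya.
  by have := depS rta (par_cell rt0 yC) p0a; rewrite rev_y pE; lia.
rewrite -pE; apply: (mem_up_par rt0 (root_cell rta)).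
by apply: IH; rewrite ?pE.
Qed.

End Reroot.

(** * The tree T_X: its cells, edges and decorations *)

Section SubTree.
Variables (T : finType) (t : dtree T) (v0 : T) (X : {set T}).
Hypotheses (dec : decorated t) (pr : pseudo_root t v0) (XA : X \subset Ann t).

Local Notation q := (dq t).
Local Notation TX := (TX t v0 X).
Local Notation EX := (EX t v0 X).
Local Notation VX := (VX t v0 X).
Local Notation newV := (newV t v0 X).
Local Notation bv := (bv t v0 X).
Definition CX : {set T} := VX :|: X.

Lemma dec_disj : [disjoint dV t & dA t]. Proof. by case: dec. Qed.
Lemma dec_edges e : e \in dE t -> (e \subset cells t) && (#|e| == 2).
Proof. by case: dec => _ [h _]; apply: h. Qed.
Lemma dec_tree : is_tree t. Proof. by case: dec => _ [_ []]. Qed.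
Lemma dec_arrow b : b \in dA t -> valency t b = 1%N.
Proof. by case: dec => _ [_ [_ [h _]]]; apply: h. Qed.
Lemma dec_qarrow e b : e \in dE t -> b \in dA t -> b \in e -> q e b = 1.
Proof. by case: dec => _ [_ [_ [_ [h _]]]]; apply: h. Qed.
Lemma v0_vertex : v0 \in dV t. Proof. by case: pr. Qed.
Lemma v0_cell : v0 \in cells t. Proof. by rewrite inE v0_vertex. Qed.
Lemma Ann_arrow b : b \in Ann t -> b \in dA t.
Proof. by rewrite inE => /andP[]. Qed.
Lemma X_arrow b : b \in X -> b \in dA t.
Proof. by move=> /(subsetP XA)/Ann_arrow. Qed.
Lemma arrow_cell b : b \in dA t -> b \in cells t.
Proof. by rewrite [_ \in cells _]inE => ->; rewrite orbT. Qed.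
Lemma X_cell b : b \in X -> b \in cells t. Proof. by move/X_arrow/arrow_cell. Qed.
Lemma arrow_neq_v0 b : b \in dA t -> b != v0.
Proof.
by move=> bA; apply: contraTneq bA => ->; rewrite (disjointFr dec_disj v0_vertex).
Qed.

Lemma CX_cell x : x \in CX -> x \in cells t.
Proof.
by rewrite inE => /orP[|/X_cell//]; rewrite !inE => /andP[->].
Qed.

Section RootV0.
Variables (par0 : T -> T) (dep0 : T -> nat).
Hypothesis rt0 : rooted t v0 par0 dep0.
Local Notation up0 := (ancestors par0 dep0).

Lemma onpathXP x :
  reflect (exists2 b, b \in X & x \in b :: up0 b) (onpathX t v0 X x).
Proof.
apply: (iffP exists_inP) => -[b bX xb]; exists b => //; move: xb;
  by rewrite (mem_gammaC dec_tree (X_cell bX) v0_cell) (gamma_up rt0 (X_cell bX)).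
Qed.

(** An arrow on the path from [b] to [v0] can only be [b] itself: having valency 1 and not being the
    root, it is not a parent. So no arrow outside [X] lies on these paths. *)
Lemma mem_CXP x : reflect (exists2 b, b \in X & x \in b :: up0 b) (x \in CX).
Proof.
apply: (iffP idP) => [|[b bX xb]].
  rewrite !inE => /orP[/andP[_ /onpathXP//]|xX].
  by exists x; rewrite ?mem_head.
have xC := mem_up_cell rt0 (X_cell bX) xb.
move: (xC); rewrite inE => /orP[xV|xA].
  by rewrite !inE xV; apply/orP; left; apply/onpathXP; exists b.
move: (xb); rewrite inE => /orP[/eqP->|]; first by rewrite inE bX orbT.
rewrite (up_map par0 dep0) => /mapP[c]; rewrite (mem_chain rt0 _ (X_cell bX)).
move=> /andP[cb cv0] xE; have cC := mem_up_cell rt0 (X_cell bX) cb.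
have := off_edges_arrow rt0 xC (arrow_neq_v0 xA) (dec_arrow xA).
rewrite (off_edges_children rt0 xC) => /setP/(_ [set c; par0 c]).
rewrite in_set0 => /imsetP[]; exists c => //.
by rewrite inE in_setD1 cv0 cC -xE /=.
Qed.

Lemma par0_CX x : x \in CX -> par0 x \in CX.
Proof.
move=> /mem_CXP[b bX xb]; apply/mem_CXP; exists b => //.
by apply: (mem_up_par rt0) => //; exact: X_cell.
Qed.

Lemma up0_CX x c : x \in CX -> c \in x :: up0 x -> c \in CX.
Proof.
move=> xX; move: xX (CX_cell xX) => + xC.
elim/(up_ind rt0): x / xC => [|x xC xv0 IH] xX.
  by rewrite (up_root rt0) inE => /eqP->.
by rewrite (up_par rt0) // inE => /orP[/eqP->//|]; apply/IH/par0_CX.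
Qed.

Lemma pedges_v0P x e : x \in cells t ->
  reflect (exists c, [/\ c \in x :: up0 x, c != v0 & e = [set c; par0 c]])
          (e \in pedges v0 (gamma t v0 x)).
Proof.
move=> xC; rewrite (mem_pedges_gammaC dec_tree xC v0_cell) (gamma_up rt0 xC) pedges_up.
apply: (iffP mapP) => [[c]|[c [cx cv0 ->]]].
  by rewrite (mem_chain rt0 _ xC) => /andP[cx cv0] ->; exists c.
by exists c => //; rewrite (mem_chain rt0 _ xC) cx.
Qed.

Lemma mem_EXP e :
  reflect (exists c, [/\ c \in CX, c != v0 & e = [set c; par0 c]]) (e \in EX).
Proof.
apply: (iffP idP) => [|[c [/mem_CXP[b bX cb] cv0 eqe]]].
  rewrite inE => /andP[_ /exists_inP[b bX /(pedges_v0P _ (X_cell bX))[c [cb cv0 ->]]]].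
  by exists c; split=> //; apply/mem_CXP; exists b.
have cC := mem_up_cell rt0 (X_cell bX) cb.
rewrite inE eqe (par_edge rt0) //=; apply/exists_inP; exists b => //.
by apply/(pedges_v0P _ (X_cell bX)); exists c.
Qed.

(** At [v0] and at arrows all decorations are 1. At another vertex the path from [v0] stays in [EX],
    so the removed edges are off this path and the pseudo-root condition applies. *)
Lemma cut_edges_le1 v : v \in CX ->
  (#|[set e in [set e in dE t | (v \in e) && (e \notin EX)] | q e v != 1]| <= 1)%N.
Proof.
move=> vX; have vC := CX_cell vX; have [_ q1 le1] := pr.
have triv : (forall e, e \in dE t -> v \in e -> q e v = 1) ->
  (#|[set e in [set e in dE t | (v \in e) && (e \notin EX)] | q e v != 1]| <= 1)%N.
  move=> h; rewrite (_ : [set _ in _ | _] = set0) ?cards0 //.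
  apply/setP => e; rewrite !inE; apply/negP => /andP[/and3P[eE ve _]].
  by rewrite h ?eqxx.
have [vv0|vv0] := eqVneq v v0; first by rewrite vv0 in triv *; apply: triv.
move: (vC); rewrite inE => /orP[vV|vA]; last first.
  by apply: triv => e eE; apply: dec_qarrow.
apply: leq_trans (le1 v vV vv0); apply/subset_leq_card/subsetP => e.
move=> /setIdP[/setIdP[eE /andP[ve ne]] qe].
apply/setIdP; split=> //; rewrite ve qe andbT /=.
apply: contra ne => /(pedges_v0P _ vC)[c [cv cv0 ->]].
by apply/mem_EXP; exists c; split=> //; apply: up0_CX cv.
Qed.

End RootV0.

Lemma tree_root x : x \in cells t -> exists par dep, rooted t x par dep.
Proof. exact: tree_rooted dec_tree dec_edges _. Qed.

Lemma inl_cell x : (inl x \in cells TX) = (x \in CX).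
Proof.
rewrite !inE !mem_imset; try by move=> ? ? [].
rewrite !inE; case: (_ \in X); rewrite ?orbT //= !orbF.
by case: imsetP => [[]|]; rewrite ?orbF.
Qed.

Lemma inr_cell x : (inr x \in cells TX) = (x \in newV).
Proof.
rewrite !inE [_ \in [set inr _ | _ in _]]mem_imset; last by move=> ? ? [].
by case: imsetP => [[]//|_]; case: imsetP => [[]//|_]; rewrite !inE.
Qed.

Lemma newV_CX x : x \in newV -> x \in CX.
Proof. by rewrite inE => /andP[xV _]; rewrite inE xV. Qed.

Definition lift_edge (e : {set T}) : {set T + T} := [set inl y | y in e].

Lemma mem_lift_edge e x : (inl x \in lift_edge e) = (x \in e).
Proof. by rewrite mem_imset // => ? ? []. Qed.

Lemma inr_lift_edge e x : (inr x \in lift_edge e) = false.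
Proof. by apply/imsetP => -[]. Qed.

Lemma lift_edge_inj : injective lift_edge.
Proof. by move=> e e' /setP eqe; apply/setP => x; rewrite -!mem_lift_edge. Qed.

Lemma lift_edge2 x y : lift_edge [set x; y] = [set inl x; inl y].
Proof. by rewrite /lift_edge imsetU !imset_set1. Qed.

Lemma mem_EX e : (lift_edge e \in dE TX) = (e \in EX).
Proof.
rewrite inE mem_imset; last exact: lift_edge_inj.
case: imsetP => [[v _ eqe]|]; rewrite ?orbF //.
by have := inr_lift_edge e v; rewrite eqe set22.
Qed.

Lemma mem_new v : ([set inl v; inr v] \in dE TX) = (v \in newV).
Proof.
rewrite inE; case: imsetP => [[e _ eqe]|_] /=.
  by have := inr_lift_edge e v; rewrite -[lift_edge e]eqe set22.
apply/imsetP/idP => [[u uN eqe]|vN]; last by exists v.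
have : inl v \in [set @inl T T u; inr u] by rewrite -eqe set21.
by case/set2P => // -[->].
Qed.

Lemma edgeTXP e : e \in dE TX ->
  (exists2 e', e' \in EX & e = lift_edge e') \/
  (exists2 v, v \in newV & e = [set inl v; inr v]).
Proof. by rewrite inE => /orP[] /imsetP[x xS ->]; [left|right]; exists x. Qed.

Lemma q_lift e v : dq TX (lift_edge e) (inl v) = q e v.
Proof.
rewrite /= (_ : _ && _ = false); last first.
  apply/andP => -[_ /eqP eqe]; have := inr_lift_edge e v.
  by rewrite eqe set22.
by congr (q _ _); apply/setP => x; rewrite inE mem_lift_edge.
Qed.

Lemma q_new v : v \in newV -> dq TX [set inl v; inr v] (inl v) = bv v.
Proof. by move=> vN; rewrite /= vN eqxx. Qed.

(** A set with at most one element, so that vertices with and without a new arrow are treated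
    alike. *)
Definition new_edge (v : T) : {set {set T + T}} :=
  if v \in newV then [set [set inl v; inr v]] else set0.

Lemma edges_at_TX v :
  edges_at TX (inl v) = lift_edge @: [set e in EX | v \in e] :|: new_edge v.
Proof.
apply/setP => e; rewrite [LHS]inE [RHS]in_setU; apply/andP/orP => [[eE ve]|].
  case: (edgeTXP eE) => [[e' e'X eqe]|[u uN eqe]].
    by left; rewrite eqe imset_f // inE e'X -mem_lift_edge -eqe.
  right; move: ve; rewrite eqe => /set2P[[->]|//].
  by rewrite /new_edge uN set11.
case=> [/imsetP[e' + ->]|]; first by rewrite inE mem_EX mem_lift_edge => /andP.
rewrite /new_edge; case: ifP => vN; last by rewrite in_set0.
by move/set1P->; rewrite mem_new set21.
Qed.

Lemma new_edge_disj v (S : {set {set T}}) : [disjoint lift_edge @: S & new_edge v].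
Proof.
rewrite disjoints_subset; apply/subsetP => e /imsetP[e' _ ->].
rewrite inE /new_edge; case: ifP => vN; rewrite !inE //.
by apply/eqP => eqe; have := inr_lift_edge e' v; rewrite eqe set22.
Qed.

(** Without a new arrow the product is empty, and [bv v] is 1: for a vertex because [v] is not in
    [newV], for an arrow because its decorations are 1. *)
Lemma prod_new_edge v : v \in CX ->
  \prod_(e in new_edge v) dq TX e (inl v) = bv v.
Proof.
rewrite inE /new_edge => vX; case: ifP => [vN|]; first by rewrite big_set1 q_new.
rewrite big_set0 inE; case/orP: vX => [->/=|vX _]; first by case: eqP.
rewrite /Defs.bv big1 // => e /and3P[eE ve _].
by apply: dec_qarrow (X_arrow vX) ve.
Qed.

(** The only edge at [b] starts the path to [v0], hence is kept, and no new arrow is attached to an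
    arrow. *)
Lemma valency_TX b : b \in X -> valency TX (inl b) = 1%N.
Proof.
move=> bX; have bA := X_arrow bX.
rewrite /valency edges_at_TX (_ : new_edge b = set0); last first.
  rewrite /new_edge ifN // !inE (disjointFl dec_disj bA) //.
rewrite setU0 card_imset; last exact: lift_edge_inj.
rewrite (_ : [set _ in _ | _] = edges_at t b); first exact: dec_arrow.
have [par0 [dep0 rt0]] := tree_root v0_cell.
have bE : [set b; par0 b] \in EX.
  apply/(mem_EXP rt0); exists b; split=> //; last exact: arrow_neq_v0.
  by rewrite inE bX orbT.
have : valency t b = 1%N by exact: dec_arrow.
move=> /eqP/cards1P[e0 eqE].
have : [set b; par0 b] \in edges_at t b.
  by rewrite (pedge_in rt0) ?(X_cell bX) ?(arrow_neq_v0 bA).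
rewrite eqE => /set1P e0E; apply/setP => e; apply/idP/idP.
  by rewrite -eqE => /setIdP[+ be]; rewrite !inE be => /andP[->].
by move/set1P->; rewrite inE -e0E bE set21.
Qed.

Lemma AnnTX : Ann TX = inl @: X.
Proof.
apply/setP => -[x|x]; last first.
  rewrite [RHS](_ : _ = false); last by apply/imsetP => -[].
  by rewrite !inE /= eqxx andbT andNb.
rewrite mem_imset; last by move=> ? ? [].
rewrite !inE /= mem_imset; last by move=> ? ? [].
have -> : (inl x \in [set @inr T T v | v in newV]) = false by apply/imsetP => -[].
rewrite orbF; case xX: (x \in X); rewrite //= ?andbF // andbT.
have := subsetP XA _ xX; rewrite !inE => /andP[].
by case: (_ == 0); rewrite ?andbT //= => /negPf->.
Qed.

Lemma disjTX : [disjoint dV TX & dA TX].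
Proof.
rewrite disjoints_subset; apply/subsetP => c /imsetP[v vV ->].
rewrite !inE negb_or; apply/andP; split; apply/imsetP => -[u uX] // [vu].
move: vV; rewrite vu !inE (disjointFl dec_disj (X_arrow uX)) //.
Qed.

(** * The two trees [t] and T_X rooted at the same arrow [a] of [X] *)

Section RootA.
Variables (a : T) (para : T -> T) (depa : T -> nat).
Hypotheses (aX : a \in X) (rta : rooted t a para depa).

Definition parTX (c : T + T) : T + T :=
  match c with inl x => inl (para x) | inr x => inl x end.
Definition depTX (c : T + T) : nat :=
  match c with inl x => depa x | inr x => (depa x).+1 end.

Lemma root_in_CX : a \in CX. Proof. by rewrite inE aX orbT. Qed.

(** If the step towards [a] is also the step towards [v0], closure of [CX] towards [v0] suffices.
    Otherwise the edge is reversed and [para x] is on the path from [a] to [v0]. *)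
Lemma para_CX x : x \in CX -> x != a -> para x \in CX /\ [set x; para x] \in EX.
Proof.
move=> xX xa; have xC := CX_cell xX; have [par0 [dep0 rt0]] := tree_root v0_cell.
have [[xv0 pE]|[pv0 pE]] := straight_or_reversed rta rt0 xC xa.
  by rewrite -pE (par0_CX rt0) //; split=> //; apply/(mem_EXP rt0); exists x.
have pX : para x \in CX.
  apply/(mem_CXP rt0); exists a => //; apply: (reversed_on_chain rt0 rta) => //.
  - exact: par_cell rta _ xC.
  - by rewrite pE.
  - by rewrite pE.
by split=> //; apply/(mem_EXP rt0); exists (para x); rewrite pE setUC.
Qed.

Lemma EX_para e : e \in EX -> exists x, [/\ x \in CX, x != a & e = [set x; para x]].
Proof.
have [par0 [dep0 rt0]] := tree_root v0_cell.
case/(mem_EXP rt0) => c [cX cv0 ->].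
have [[xa pE]|[pa pE]] := straight_or_reversed rt0 rta (CX_cell cX) cv0.
  by exists c; rewrite pE.
by exists (par0 c); rewrite pE setUC (par0_CX rt0).
Qed.

(** The rooting of [t] restricts to T_X, with each new arrow hanging below its vertex; the formulas
    for rooted trees thus hold in T_X as well. *)
Lemma rootedTX : rooted TX (inl a) parTX depTX.
Proof.
split=> /=.
- by rewrite inl_cell root_in_CX.
- by rewrite (par_root rta).
- exact: dep_root rta.
- move=> [x|x]; rewrite /= ?inl_cell ?inr_cell; last exact: newV_CX.
  move=> xX; have [->|xa] := eqVneq x a; first by rewrite (par_root rta) root_in_CX.
  by case: (para_CX xX xa).
- move=> [x|x]; rewrite ?inl_cell ?inr_cell // => xX xa.
  by apply: (depS rta) => //; apply: CX_cell.
- move=> [x|x]; rewrite ?inl_cell ?inr_cell => xX xa.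
    by rewrite -lift_edge2 mem_EX; case: (para_CX xX xa).
  by rewrite setUC mem_new.
move=> e /edgeTXP[[e' /EX_para[x [xX xa ->]] ->]|[v vN ->]].
  by exists (inl x); rewrite inl_cell lift_edge2.
by exists (inr v); rewrite inr_cell setUC.
Qed.

Local Notation others := (off_edges t para).
Local Notation othersTX := (off_edges TX parTX).

Definition kept v := [set e in others v | e \in EX].
Definition cut v := [set e in others v | e \notin EX].

Lemma in_others v e :
  (e \in others v) = [&& e != [set v; para v], e \in dE t & v \in e].
Proof. by rewrite in_setD1 in_set. Qed.

Lemma in_kept v e : (e \in kept v) = (e \in others v) && (e \in EX).
Proof. by rewrite in_set. Qed.

Lemma in_cut v e : (e \in cut v) = (e \in others v) && (e \notin EX).
Proof. by rewrite in_set. Qed.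

Lemma others_split v : others v = kept v :|: cut v.
Proof. by apply/setP => e; rewrite in_setU in_kept in_cut -andb_orr orbN andbT. Qed.

Lemma disj_kept_cut v : [disjoint kept v & cut v].
Proof.
rewrite disjoints_subset; apply/subsetP => e; rewrite in_setC in_kept in_cut.
by case/andP => _ ->; rewrite andbF.
Qed.

(** The edge from [v] towards [a] lies in [EX], so the cut edges are exactly those whose decorations
    make up [bv v]. *)
Lemma cutE v : v \in CX -> cut v = [set e in dE t | (v \in e) && (e \notin EX)].
Proof.
move=> vX; apply/setP => e; rewrite in_cut in_others [in RHS]in_set.
case eX: (e \in EX); rewrite ?andbF //= !andbT.
case eE: (e \in dE t); rewrite ?andbF //= (_ : _ != _) //.
apply: contraFneq eX => eqe; have [va|va] := eqVneq v a.
  by have := root_edgeN rta; rewrite -va -eqe eE.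
by rewrite eqe; case: (para_CX vX va).
Qed.

Lemma prod_cut v : v \in CX -> \prod_(e in cut v) q e v = bv v.
Proof.
by move=> vX; rewrite cutE // /Defs.bv; apply: eq_bigl => e; rewrite inE.
Qed.

Lemma othersTX_split v : othersTX (inl v) = lift_edge @: kept v :|: new_edge v.
Proof.
rewrite /off_edges edges_at_TX /= -lift_edge2 setDUl; congr (_ :|: _).
  apply/setP => e; apply/setD1P/imsetP => [[ne /imsetP[e' e'X eqe]]|[e' e'X ->]].
    exists e' => //; move: e'X => /setIdP[e'X ve].
    rewrite eqe (inj_eq lift_edge_inj) in ne.
    by rewrite in_kept in_others ne e'X ve; move/setIdP: e'X => [->].
  move: e'X; rewrite in_kept in_others => /andP[/and3P[ne eE ve] eX].
  rewrite (inj_eq lift_edge_inj); split=> //.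
  by apply: imset_f; apply/setIdP.
apply/setDidPl; rewrite -imset_set1 disjoint_sym; exact: new_edge_disj.
Qed.

(** At [para c] the cut edges and the new edge have the same product. *)
Lemma sideprodTX c : c \in CX -> c != a ->
  sideprod TX parTX (inl c) = sideprod t para c.
Proof.
move=> cX ca; have [pX eX] := para_CX cX ca.
rewrite /sideprod othersTX_split [parTX _]/= -lift_edge2 others_split !setDUl.
set p := para c; set e0 := [set c; p].
have -> : new_edge p :\ lift_edge e0 = new_edge p.
  apply/setDidPl; rewrite -imset_set1 disjoint_sym; exact: new_edge_disj.
have -> : cut p :\ e0 = cut p.
  by apply/setDidPl; rewrite disjoint_sym disjoints1 in_cut eX andbF.
rewrite (imset_setD1 _ _ lift_edge_inj).
rewrite !big_setU_disjoint ?new_edge_disj //; last first.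
  exact: disjointWl (subD1set _ _) (disj_kept_cut _).
rewrite prod_new_edge // prod_cut // big_imset /=; last first.
  by move=> ? ? _ _; apply: lift_edge_inj.
by congr (_ * _); apply: eq_bigr => e _; rewrite -[RHS]q_lift.
Qed.

Lemma chainprodTX x : x \in CX ->
  chainprod TX parTX depTX (inl x) = chainprod t para depa x.
Proof.
move=> xX; move: xX (CX_cell xX) => + xC.
elim/(up_ind rta): x / xC => [|x xC xa IH] xX.
  by rewrite (chainprod_root rootedTX) (chainprod_root rta).
rewrite (chainprod_par rta) // (chainprod_par rootedTX) ?inl_cell //.
by rewrite sideprodTX // IH //; case: (para_CX xX xa).
Qed.

(** The cut edges and the new edge have the same product [bv v] and both have defect -1, so
    [defectU] gives equal results. *)
Lemma defectTX v : v \in CX ->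
  defect (othersTX (inl v)) (dq TX ^~ (inl v)) = defect (others v) (q^~ v).
Proof.
move=> vX; rewrite othersTX_split others_split !defectU ?new_edge_disj //;
  last exact: disj_kept_cut.
rewrite prod_new_edge // prod_cut // defect_imset; last exact: lift_edge_inj.
rewrite big_imset /=; last by move=> ? ? _ _; apply: lift_edge_inj.
have [par0 [dep0 rt0]] := tree_root v0_cell.
rewrite [defect (cut v) _]defect_le1 ?cutE ?(cut_edges_le1 rt0) //.
rewrite [defect (new_edge v) _](_ : _ = -1); last first.
  by rewrite /new_edge; case: ifP; rewrite ?defect1 ?defect0.
congr (_ * _ + _ * _); last by apply: eq_bigr => e _; rewrite -[RHS]q_lift.
by apply: eq_in_defect => e _; rewrite -[RHS]q_lift.
Qed.

(** Off [CX] the steps towards [a] and [v0] agree, since a reversed edge would put [v] on the path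
    from [a] to [v0]. The other edges at [v] are therefore off the path from [v0], as the
    pseudo-root condition requires. *)
Lemma defect_off v : v \in cells t -> v \notin CX ->
  defect (others v) (q^~ v) = -1.
Proof.
move=> vC vX; have [par0 [dep0 rt0]] := tree_root v0_cell.
have va : v != a by apply: contraNneq vX => ->; exact: root_in_CX.
have vv0 : v != v0.
  apply: contraNneq vX => ->; apply/(mem_CXP rt0); exists a => //.
  by apply: (root_in_up rt0); apply: X_cell.
have pE : para v = par0 v.
  have [[]//|[pa pE]] := straight_or_reversed rt0 rta vC vv0.
  case/negP: vX; apply/(mem_CXP rt0); exists a => //.
  exact: (reversed_on_chain rt0 rta).
move: (vC); rewrite inE => /orP[vV|vA]; last first.
  apply: defect_triv => e; rewrite in_others => /and3P[_ eE ve].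
  exact: dec_qarrow.
have [_ _ le1] := pr; apply: defect_le1; apply: leq_trans (le1 v vV vv0).
apply/subset_leq_card/subsetP => e.
move=> /setIdP[]; rewrite in_others => /and3P[ne eE ve] qe.
apply/setIdP; split=> //; rewrite ve qe andbT /=.
apply: contra ne => /(pedges_v0P rt0 _ vC)[c [cv cv0 eqe]].
have cC := mem_up_cell rt0 vC cv.
move: ve; rewrite eqe pE !inE => /orP[/eqP->//|/eqP vE].
by have := dep_le_up rt0 vC cv; have := depS rt0 cC cv0; rewrite -vE; lia.
Qed.

Lemma defect_new v : defect (othersTX (inr v)) (dq TX ^~ (inr v)) = -1.
Proof.
rewrite (_ : othersTX _ = set0) ?defect0 //.
apply/setP => e; rewrite in_set0; apply/negP.
rewrite in_setD1 in_set => /and3P[ne eE ve].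
case: (edgeTXP eE) => [[e' _ eqe]|[u _ eqe]].
  by rewrite eqe inr_lift_edge in ve.
by move: ve ne; rewrite eqe => /set2P[//|[->]]; rewrite /= setUC eqxx.
Qed.

(** New arrows and cells off [CX] have defect -1 and contribute nothing; the remaining terms agree
    one by one. *)
Lemma sum_defectTX :
  \sum_(c in cells TX :\ inl a)
     chainprod TX parTX depTX c * (defect (othersTX c) (dq TX ^~ c) + 1)
  = \sum_(v in cells t :\ a)
     chainprod t para depa v * (defect (others v) (q^~ v) + 1).
Proof.
rewrite big_sumType /= [X in _ + X]big1 ?addr0; last first.
  by move=> v _; rewrite defect_new addNr mulr0.
rewrite [RHS](bigID (fun v => v \in CX)) /= [X in _ = _ + X]big1 ?addr0; last first.
  move=> v /andP[]; rewrite in_setD1 => /andP[_ vC] vX.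
  by rewrite defect_off // addNr mulr0.
have inlI : injective (@inl T T) by move=> ? ? [].
apply: eq_big => [v|v]; rewrite !in_setD1 inl_cell.
  by rewrite (inj_eq inlI); case vX: (v \in CX); rewrite ?andbF // (CX_cell vX) ?andbT.
by case/andP => _ vX; rewrite chainprodTX // defectTX.
Qed.

(** Apply [sum_xva] in both trees. The defect sums agree, and the arrow sums differ by the arrows
    outside [X]. *)
Lemma sum_xvaTX :
  \sum_(v in dV t :|: A0 t) xva t v a * ((valency t v)%:Z - 2)
  = \sum_(c in dV TX :|: A0 TX) xva TX c (inl a) * ((valency TX c)%:Z - 2)
    + df t a * \sum_(b in Ann t :\: X) Qstar t b (gamma t b a).
Proof.
have aA := subsetP XA _ aX.
have rA b : b \in Ann t -> valency t b = 1%N by move/Ann_arrow/dec_arrow.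
rewrite (sum_xva rta (rA _ aA) dec_disj aA rA).
rewrite (sum_xva rootedTX (valency_TX aX) disjTX); first last.
- by move=> c; rewrite AnnTX => /imsetP[b bX ->]; apply: valency_TX.
- by rewrite AnnTX imset_f.
rewrite sum_defectTX [df TX _]/= -mulrDr -!addrA; congr (_ * (_ + (_ + _))).
rewrite (bigID (fun b => b \in X)) /=; congr (_ + _).
  rewrite AnnTX big_sumType /= [X in _ = _ + X]big1 ?addr0; last first.
    by move=> b; rewrite in_setD1 => /andP[_ /imsetP[]].
  apply: eq_big => [b|b].
    rewrite !in_setD1 mem_imset; last by move=> ? ? [].
    rewrite (inj_eq _); last by move=> ? ? [].
    by case bX: (b \in X); rewrite ?andbF // (subsetP XA) ?andbT.
  by case/andP => _ bX; rewrite chainprodTX // inE bX orbT.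
apply: eq_big => [b|b].
  rewrite in_setD1 in_setD andbC; have [->|//] := eqVneq b a.
  by rewrite aX.
rewrite in_setD1 => /andP[/andP[ba bA] _].
by rewrite (Qstar_chainprod rta (rA _ aA)) // arrow_cell // Ann_arrow.
Qed.

End RootA.

End SubTree.

(** * Sums over arrows and over disjoint unions *)

Definition msum (T : finType) (t : dtree T) (a : T) : int :=
  \sum_(v in dV t :|: A0 t) xva t v a * ((valency t v)%:Z - 2).

Lemma Minv_msum (T : finType) (t : dtree T) : Minv t = - \sum_(a in Ann t) msum t a.
Proof.
rewrite /Minv /msum exchange_big /=; congr (- _); apply: eq_bigr => v _.
by rewrite /Nv mulr_suml.
Qed.

Lemma sum_bigcup (K T : finType) (D : pred K) (X : K -> {set T}) (G : T -> rat) :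
  (forall i j, D i -> D j -> i != j -> [disjoint X i & X j]) ->
  \sum_(a in \bigcup_(i | D i) X i) G a = \sum_(i | D i) \sum_(a in X i) G a.
Proof.
(* Indices outside [D] get the empty set, which makes the family disjoint over all of [K]. *)
move=> disjX; rewrite (big_mkcond D X) partition_disjoint_bigcup /=; last first.
  move=> i j ij; case: ifP => Di; last by rewrite disjoints_subset sub0set.
  case: ifP => Dj; first exact: disjX.
  by rewrite disjoint_sym disjoints_subset sub0set.
rewrite [RHS]big_mkcond; apply: eq_bigr => i _.
by case: ifP => // _; rewrite big_set0.
Qed.

(** * The invariants of a single block *)

Section Blocks.
Variables (T : finType) (t : dtree T) (v0 : T).
Hypotheses (dec : decorated t) (pr : pseudo_root t v0).

(** [fQf a b] is the summand of [Iv], and [Qf a b] is what the factor [1/f(a)] in [frakM] leaves of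
    it. *)
Definition Qf (a b : T) : rat := (Qstar t a (gamma t a b) * df t b)%:~R.
Definition fQf (a b : T) : rat := (Qstar t a (gamma t a b) * df t a * df t b)%:~R.

Lemma fQf_sym a b : a \in Ann t -> b \in Ann t -> fQf a b = fQf b a.
Proof.
move=> /Ann_arrow/arrow_cell aC /Ann_arrow/arrow_cell bC.
by rewrite /fQf (Qstar_sym (dec_tree dec) aC bC) mulrAC.
Qed.

Lemma Iv_disjoint (X Y : {set T}) : [disjoint X & Y] ->
  (Iv t X Y)%:~R = \sum_(a in X) \sum_(b in Y) fQf a b :> rat.
Proof.
move=> XY; rewrite /Iv rmorph_sum /=; apply: eq_bigr => a aX.
rewrite rmorph_sum /=; apply: eq_bigl => b.
case bY: (b \in Y) => //=; apply: contraTneq aX => ->.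
by rewrite (disjointFl XY bY).
Qed.

Section Block.
Variable X : {set T}.
Hypothesis XA : X \subset Ann t.

Lemma frakM_block :
  frakM t X = \sum_(a in X) \sum_(b in Ann t :\: X) (fQf a b - Qf a b).
Proof.
apply: eq_bigr => a aX; rewrite Iv_disjoint; last first.
  by rewrite disjoints1 in_setD aX.
rewrite big_set1 mulr_sumr; apply: eq_bigr => b _.
(* Arrows of [Ann t] have nonzero [f], so the division can be carried out. *)
have fa : (df t a)%:~R != 0 :> rat.
  rewrite intr_eq0; have := subsetP XA _ aX; rewrite !inE => /andP[+ aA].
  by rewrite aA.
by rewrite /fQf /Qf !rmorphM /=; field.
Qed.

Lemma Minv_block : (Minv (TX t v0 X))%:~R =
  - \sum_(a in X) (msum t a)%:~R
  + \sum_(a in X) \sum_(b in Ann t :\: X) Qf b a :> rat.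
Proof.
rewrite Minv_msum (AnnTX v0 XA) big_imset /=; last by move=> ? ? _ _ [].
rewrite rmorphN rmorph_sum /= -[RHS]opprK opprD opprK; congr (- _).
rewrite -sumrB; apply: eq_bigr => a aX.
have aC : a \in cells t by exact: arrow_cell (X_arrow XA aX).
have [para [depa rta]] := tree_root dec aC.
have -> : msum t a = msum (TX t v0 X) (inl a)
    + df t a * \sum_(b in Ann t :\: X) Qstar t b (gamma t b a).
  exact: (sum_xvaTX dec pr XA aX rta).
move: (msum (TX t v0 X) _) => m; rewrite mulr_sumr rmorphD rmorph_sum /=.
rewrite (eq_bigr (fun b => Qf b a)) ?addrK // => b _.
by rewrite /Qf mulrC.
Qed.

Lemma FT_block : FT (TX t v0 X) = \sum_(a in X) FX t v0 X a.
Proof. by rewrite /FT (AnnTX v0 XA) big_imset //=; move=> ? ? _ _ []. Qed.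

Definition cross (G : T -> T -> rat) : rat :=
  \sum_(a in X) \sum_(b in Ann t :\: X) G a b.

(** The terms [FX] cancel against those of [frakD], leaving values of [Fa] in [t]. The two sums of
    [Qf] are transposes of each other and cancel only after summation over all blocks. *)
Lemma delta_block : deltainv (TX t v0 X) - frakD t v0 X =
  (\sum_(a in X) (Fa t a)%:~R + \sum_(a in X) (msum t a)%:~R
   - cross (fun a b => Qf b a) + cross Qf - cross fQf) / 2.
Proof.
rewrite /deltainv /frakD Minv_block FT_block frakM_block rmorph_sum /=.
have -> : \sum_(a in X) \sum_(b in Ann t :\: X) (fQf a b - Qf a b)
    = cross fQf - cross Qf.
  by rewrite -sumrB; apply: eq_bigr => a _; rewrite sumrB.
have -> : \sum_(a in X) (Fa t a - FX t v0 X a)%:~R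
    = \sum_(a in X) (Fa t a)%:~R - \sum_(a in X) (FX t v0 X a)%:~R :> rat.
  by rewrite -sumrB; apply: eq_bigr => a _; rewrite rmorphB.
by rewrite /cross; field.
Qed.

Lemma genus_block : genus (TX t v0 X) - 1 - frakG t v0 X =
  (- \sum_(a in X) (Fa t a)%:~R + \sum_(a in X) (msum t a)%:~R
   - cross (fun a b => Qf b a) + cross Qf - cross fQf) / 2.
Proof.
rewrite /genus /frakG Minv_block FT_block frakM_block rmorph_sum /=.
have -> : \sum_(a in X) \sum_(b in Ann t :\: X) (fQf a b - Qf a b)
    = cross fQf - cross Qf.
  by rewrite -sumrB; apply: eq_bigr => a _; rewrite sumrB.
have -> : \sum_(a in X) (Fa t a - FX t v0 X a)%:~R
    = \sum_(a in X) (Fa t a)%:~R - \sum_(a in X) (FX t v0 X a)%:~R :> rat.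
  by rewrite -sumrB; apply: eq_bigr => a _; rewrite rmorphB.
by rewrite /cross; field.
Qed.

End Block.

(** * Summation over the blocks of a partition *)

Section Partition.
Variables (K : finType) (D : pred K) (X : K -> {set T}).
Hypothesis disjX : forall i j, D i -> D j -> i != j -> [disjoint X i & X j].
Hypothesis coverX : \bigcup_(i | D i) X i = Ann t.

Lemma block_sub i : D i -> X i \subset Ann t.
Proof. by move=> Di; rewrite -coverX; apply: bigcup_sup. Qed.

Lemma block_compl i : D i -> Ann t :\: X i = \bigcup_(j | D j && (j != i)) X j.
Proof.
move=> Di; apply/setP => b; apply/setDP/bigcupP => [[]|[j /andP[Dj ji] bj]].
  rewrite -coverX => /bigcupP[j Dj bj] bi; exists j => //; rewrite Dj /=.
  by apply: contraNneq bi => <-.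
split; first exact: (subsetP (block_sub Dj)).
by rewrite (disjointFr (disjX Dj Di ji) bj).
Qed.

Lemma sum_blocks (G : T -> rat) :
  \sum_(i | D i) \sum_(a in X i) G a = \sum_(a in Ann t) G a.
Proof. by rewrite -coverX sum_bigcup. Qed.

Lemma sum_cross (G : T -> T -> rat) : \sum_(i | D i) cross (X i) G =
  \sum_(i | D i) \sum_(j | D j && (j != i)) \sum_(a in X i) \sum_(b in X j) G a b.
Proof.
apply: eq_bigr => i Di; rewrite exchange_big /=; apply: eq_bigr => a _.
rewrite block_compl // sum_bigcup // => j k.
by move=> /andP[Dj _] /andP[Dk _]; apply: disjX.
Qed.

(** Both sides run over the ordered pairs of distinct blocks, a set stable under exchange. *)
Lemma sum_cross_swap (G : T -> T -> rat) :
  \sum_(i | D i) cross (X i) (fun a b => G b a) = \sum_(i | D i) cross (X i) G.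
Proof.
rewrite !sum_cross (exchange_big_dep D) /=; last by move=> i j _ /andP[].
apply: eq_bigr => j Dj; apply: eq_big => [i|i _]; last exact: exchange_big.
by rewrite Dj eq_sym.
Qed.

Lemma sum_cross_Iv : \sum_(i | D i) cross (X i) fQf =
  \sum_(i | D i) \sum_(j | D j && (j != i)) (Iv t (X i) (X j))%:~R.
Proof.
rewrite sum_cross; apply: eq_bigr => i Di; apply: eq_bigr => j /andP[Dj ji].
by rewrite Iv_disjoint //; apply: disjX; rewrite // eq_sym.
Qed.

(** Indexing by a predicate on a finite type covers both the singletons, indexed by their arrows,
    and the blocks indexed by ['I_n]. *)
Lemma delta_partition : deltainv t =
  \sum_(i | D i) deltainv (TX t v0 (X i)) - \sum_(i | D i) frakD t v0 (X i)
  + (\sum_(i | D i) \sum_(j | D j && (j != i)) (Iv t (X i) (X j))%:~R) / 2.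
Proof.
rewrite -sumrB (eq_bigr _ (fun i Di => delta_block (block_sub Di))) -mulr_suml.
rewrite -sum_cross_Iv /deltainv Minv_msum /FT !(sumrB, big_split) /=.
by rewrite !sum_blocks sum_cross_swap rmorphN !rmorph_sum /=; field.
Qed.

Lemma genus_partition : genus t - 1 =
  \sum_(i | D i) (genus (TX t v0 (X i)) - 1) - \sum_(i | D i) frakG t v0 (X i)
  + (\sum_(i | D i) \sum_(j | D j && (j != i)) (Iv t (X i) (X j))%:~R) / 2.
Proof.
rewrite -sumrB (eq_bigr _ (fun i Di => genus_block (block_sub Di))) -mulr_suml.
rewrite -sum_cross_Iv /genus Minv_msum /FT !(sumrB, big_split) /= sumrN.
by rewrite !sum_blocks sum_cross_swap rmorphN !rmorph_sum /=; field.
Qed.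

End Partition.

Lemma Iv_singletons :
  \sum_(a in Ann t) \sum_(b in Ann t | b != a) (Iv t [set a] [set b])%:~R
  = (Iv t (Ann t) (Ann t))%:~R :> rat.
Proof.
rewrite /Iv rmorph_sum; apply: eq_bigr => a _ /=; rewrite rmorph_sum /=.
apply: eq_big => [b|b /andP[_ ba]]; first by rewrite eq_sym.
by rewrite big_set1 big_mkcondr big_set1 eq_sym ba.
Qed.

(** [Iv] is symmetric on distinct blocks because [Qstar] is, so ordered pairs count each unordered
    pair twice. *)
Lemma Iv_pairs n (X : 'I_n -> {set T}) :
  (forall i j, i != j -> [disjoint X i & X j]) ->
  \bigcup_(i < n) X i = Ann t ->
  (\sum_(i < n) \sum_(j < n | j != i) (Iv t (X i) (X j))%:~R) / 2
  = \sum_(i < n) \sum_(j < n | (i < j)%N) (Iv t (X i) (X j))%:~R :> rat.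
Proof.
move=> disjX coverX.
have XA i : X i \subset Ann t by rewrite -coverX; apply: (bigcup_sup i).
have Isym i j : i != j -> (Iv t (X i) (X j))%:~R = (Iv t (X j) (X i))%:~R :> rat.
  move=> ij; rewrite !Iv_disjoint ?disjX // 1?eq_sym // exchange_big /=.
  apply: eq_bigr => a aj; apply: eq_bigr => b bi.
  exact: fQf_sym (subsetP (XA i) _ bi) (subsetP (XA j) _ aj).
have -> : \sum_(i < n) \sum_(j < n | j != i) (Iv t (X i) (X j))%:~R
  = \sum_(i < n) \sum_(j < n | (i < j)%N) (Iv t (X i) (X j))%:~R
  + \sum_(i < n) \sum_(j < n | (j < i)%N) (Iv t (X i) (X j))%:~R :> rat.
  rewrite -big_split /=; apply: eq_bigr => i _.
  rewrite (bigID (fun j : 'I_n => (i < j)%N)) /=; congr (_ + _);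
    apply: eq_bigl => j; rewrite -val_eqE /=; lia.
have -> : \sum_(i < n) \sum_(j < n | (j < i)%N) (Iv t (X i) (X j))%:~R
  = \sum_(i < n) \sum_(j < n | (i < j)%N) (Iv t (X i) (X j))%:~R :> rat.
  rewrite (exchange_big_dep predT) //=; apply: eq_bigr => j _.
  apply: eq_bigr => i ji; apply: Isym.
  by rewrite -val_eqE /=; lia.
by field.
Qed.

End Blocks.

Theorem theorem4p19 (T : finType) (t : dtree T) (v0 : T)
  (n : nat) (X : 'I_n -> {set T}) :
  decorated t -> pseudo_root t v0 ->
  (forall i, X i != set0) ->
  (forall i j, i != j -> [disjoint X i & X j]) ->
  \bigcup_(i < n) X i = Ann t ->
  [/\ deltainv t =
        \sum_(a in Ann t) deltainv (TX t v0 [set a])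
        - \sum_(a in Ann t) frakD t v0 [set a]
        + (Iv t (Ann t) (Ann t))%:~R / 2,
      deltainv t =
        \sum_(i < n) deltainv (TX t v0 (X i))
        - \sum_(i < n) frakD t v0 (X i)
        + \sum_(i < n) \sum_(j < n | (i < j)%N) (Iv t (X i) (X j))%:~R,
      genus t - 1 =
        \sum_(a in Ann t) (genus (TX t v0 [set a]) - 1)
        - \sum_(a in Ann t) frakG t v0 [set a]
        + (Iv t (Ann t) (Ann t))%:~R / 2 &
      genus t - 1 =
        \sum_(i < n) (genus (TX t v0 (X i)) - 1)
        - \sum_(i < n) frakG t v0 (X i)
        + \sum_(i < n) \sum_(j < n | (i < j)%N) (Iv t (X i) (X j))%:~R].
Proof.
move=> dec pr _ disjX coverX.
have disj1 (a b : T) : a \in Ann t -> b \in Ann t -> a != b ->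
    [disjoint [set a] & [set b]].
  by move=> _ _ ab; rewrite disjoints1 inE.
have cover1 : \bigcup_(a in Ann t) [set a] = Ann t.
  apply/setP => b; apply/bigcupP/idP => [[a aA /set1P->]|bA] //.
  by exists b; rewrite ?set11.
have disjT i j : true -> true -> i != j -> [disjoint X i & X j].
  by move=> _ _; apply: disjX.
(* Both intersection terms become sums over ordered pairs, the form of the partition lemmas; (a) and
   (c) then come from the partition into singletons. *)
rewrite -(Iv_pairs dec disjX coverX) -(Iv_singletons t); split.
- exact: (delta_partition dec pr disj1 cover1).
- exact: (delta_partition dec pr disjT coverX).
- exact: (genus_partition dec pr disj1 cover1).
- exact: (genus_partition dec pr disjT coverX).
Qed.
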